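(* Let $H\in(0,1)$, $1<\alpha\le2$, and let $Z^H=\{Z^H(t),t\ge0\}$, $Z^H(t)=W^H(L_t)$, be the $\alpha$-stable local time $H$-fractional Brownian motion with values in $\mathbb{R}$. Then there exists a finite constant $A_9>0$ such that for all constants $0\le a<b<\infty$, $$\limsup_{h\downarrow0}\ \sup_{a\le t\le b-h}\ \sup_{0\le s\le h}\frac{|Z^H(t+s)-Z^H(t)|}{h^{H(\alpha-1)/\alpha}\,(\log 1/h)^{(\alpha+2H)/(2\alpha)}}\le A_9\qquad\text{a.s.}$$
   Context: $W^H=\{W^H(t),t\in\mathbb{R}\}$ is a real-valued fractional Brownian motion of Hurst index $H$: a centered Gaussian process with continuous sample paths, $W^H(0)=0$ and $\mathbb{E}(W^H(s)W^H(t))=\frac12(|s|^{2H}+|t|^{2H}-|s-t|^{2H})$. $X=\{X_t,t\ge0\}$ is a real-valued strictly stable Lévy process of index $\alpha\in(1,2]$ (with $X_0=0$), independent of $W^H$, with characteristic function $\mathbb{E}[e^{i\xi X_t}]=\exp\big(-t|\xi|^\alpha\frac{1+i\nu\,\mathrm{sgn}(\xi)\tan(\pi\alpha/2)}{\chi}\big)$, where $-1\le\nu\le1$ and $\chi>0$ are constants. The local time $L(x,t)$ of $X$ is the density with respect to Lebesgue measure of the occupation measure $A\mapsto\lambda_1\{s\in[0,t]:X_s\in A\}$, in a version jointly continuous in $(x,t)$; $L_t:=L(0,t)$ is the local time at zero. $Z^H(t)=W^H(L_t)$ for $t\ge0$. *)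

(* Defs.v *)
From HB Require Import structures.
From mathcomp Require Import all_boot all_order all_algebra.
From mathcomp Require Import all_classical all_reals all_analysis.
From mathcomp Require Import complex.

Set Implicit Arguments.
Unset Strict Implicit.
Unset Printing Implicit Defensive.

Import Order.TTheory GRing.Theory Num.Theory.
Import numFieldNormedType.Exports.

Local Open Scope classical_set_scope.
Local Open Scope ring_scope.
Local Open Scope complex_scope.

Section Laws.
Context {d : measure_display} {T : measurableType d} {R : realType}.
Variable P : probability T R.

(* [normal_prob m 0] is a junk value in the library, so that the degenerate
   normal law has to be given separately. *)
Definition normally_distributed (f : T -> R) : Prop :=
  exists m s : R, 0 <= s /\ forall A : set R, measurable A ->
    P (f @^-1` A) = if s == 0 then \d_m A else normal_prob m s A.

Definition same_law (f g : T -> R) : Prop :=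
  forall A : set R, measurable A -> P (f @^-1` A) = P (g @^-1` A).

(* The product rule for subfamilies is obtained by taking [B i := setT]. *)
Definition mutually_independent (n : nat) (f : 'I_n -> T -> R) : Prop :=
  forall B : 'I_n -> set R, (forall i, measurable (B i)) ->
    P (\bigcap_(i in [set: 'I_n]) (f i @^-1` B i)) =
    (\prod_(i < n) P (f i @^-1` B i))%E.

Definition cexp (z : R[i]) : R[i] :=
  let: x +i* y := z in (expR x * cos y) +i* (expR x * sin y).

(* E[exp(i xi f)] = E[cos(xi f)] + i E[sin(xi f)] *)
Definition char_fun (f : T -> R) (xi : R) : R[i] :=
  fine ('E_P[fun w => cos (xi * f w)%R])%E +i*
  fine ('E_P[fun w => sin (xi * f w)%R])%E.

End Laws.

Section Processes.
Context {d : measure_display} {T : measurableType d} {R : realType}.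
Variable P : probability T R.

Definition sigma_process (D : set R) (Y : R -> {RV P >-> R}) : set (set T) :=
  <<s \bigcup_(t in D) preimage_set_system [set: T] (Y t) measurable >>.

Definition independent_processes (D1 D2 : set R) (Y1 Y2 : R -> {RV P >-> R})
    : Prop :=
  forall A B : set T, sigma_process D1 Y1 A -> sigma_process D2 Y2 B ->
    P (A `&` B) = (P A * P B)%E.

Definition gaussian_process (W : R -> {RV P >-> R}) : Prop :=
  forall (n : nat) (c t : 'I_n -> R),
    normally_distributed P (fun w => \sum_(i < n) c i * W (t i) w).

Record fractional_brownian_motion (H : R) (W : R -> {RV P >-> R}) : Prop := {
  fbm_gaussian : gaussian_process W;
  fbm_centered : forall t, ('E_P[W t] = 0)%E;
  fbm_cov : forall s t,
    ('E_P[fun w => (W s w * W t w)%R] =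
     ((`|s| `^ (2 * H) + `|t| `^ (2 * H) - `|s - t| `^ (2 * H)) / 2)%:E)%E;
  fbm_start : {ae P, forall w, W 0 w = 0};
  fbm_continuous : {ae P, forall w, continuous (fun t => W t w)}
}.

(* Processes indexed by t >= 0 are total on R; nothing is assumed about them
   (nor used) at negative times. *)
Definition cadlag (x : R -> R) : Prop :=
  (forall t, 0 <= t -> x s @[s --> t^'+] --> x t) /\
  (forall t, 0 < t -> cvg (x s @[s --> t^'-])).

Record levy_process (X : R -> {RV P >-> R}) : Prop := {
  levy_start : {ae P, forall w, X 0 w = 0};
  levy_independent : forall (n : nat) (t : nat -> R), 0 <= t 0%N ->
    (forall i, t i <= t i.+1) ->
    mutually_independent P
      (fun (i : 'I_n) (w : T) => X (t i.+1) w - X (t i) w);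
  levy_stationary : forall s t, 0 <= s -> s <= t ->
    same_law P (fun w => X t w - X s w) (X (t - s));
  levy_cadlag : {ae P, forall w, cadlag (fun t => X t w)}
}.

Definition stable_char_fun (alpha nu chi t xi : R) : R[i] :=
  cexp (- (t * `|xi| `^ alpha)%:C *
    ((1 +i* (nu * Num.sg xi * tan (pi * alpha / 2))) / chi%:C)).

(* For alpha > 1, strict stability, i.e. (X_(c t))_t and (c^(1/alpha) X_t)_t
   having the same law for c > 0, is read off the characteristic function. *)
Record stable_levy_process (alpha nu chi : R) (X : R -> {RV P >-> R})
    : Prop := {
  stable_levy : levy_process X;
  stable_char : forall t xi, 0 <= t ->
    char_fun P (X t) xi = stable_char_fun alpha nu chi t xi
}.

Record local_time (X : R -> {RV P >-> R}) (L : R -> R -> {RV P >-> R})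
    : Prop := {
  local_time_density : {ae P, forall w, forall (t : R) (A : set R),
    0 <= t -> measurable A ->
    lebesgue_measure (`[0, t] `&` [set s | A (X s w)]) =
    (\int[lebesgue_measure]_(x in A) (L x t w)%:E)%E};
  local_time_continuous : {ae P, forall w,
    {within [set p : R * R | 0 <= p.2],
      continuous (fun p : R * R => L p.1 p.2 w)}}
}.

Definition local_time_fbm (W : R -> {RV P >-> R}) (L : R -> R -> {RV P >-> R})
    (t : R) (w : T) : R :=
  W (L 0 t w) w.

End Processes.

(* Main.v *)
Require Import Defs.
From mathcomp Require Import all_boot all_order all_algebra.
From mathcomp Require Import all_classical all_reals all_analysis.
From mathcomp Require Import measurable_realfun complex ring lra zify.

(** The process is [W] read along the clock [L 0 t], and the gauge is the
    composition of the moduli of continuity of these two random functions, which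
    both hold almost surely with deterministic constants:
    - [`|W u - W v| = O(r^H (log 1/r)^(1/2))] for [`|u - v| <= r], uniformly on
      compact sets ([fbm_uniform_modulus]);
    - [L 0 (t + h) - L 0 t = O(h^(1 - 1/alpha) (log 1/h)^(1/alpha))], uniformly
      for [t] in a compact set ([local_time_uniform_modulus]).
    Taking for [r] the second bound, [log 1/r] is of order [log 1/h] and the
    product of the factors is the gauge ([composed_increment_le]).

    The first one is Levy's: increments over dyadic intervals have Gaussian tails
    ([gaussian_tail]), the Borel-Cantelli lemma controls all of them at once, and
    chaining extends the control to all pairs of points ([chaining]).

    For the second one the clock is nondecreasing, so no chaining is needed and
    everything rests on a tail bound for one increment ([local_time_tail]):
    [P (L 0 (t + h) - L 0 t > y) <= 2 exp (lam h - c lam^(1 - 1/alpha) y)] for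
    all [lam > 0].  The choice of [lam] of order [(log 1/h) / h] gives the modulus.  Up to
    the factor [1 / (2 eps)], the increment is the limit of the time spent by the
    path in [`]-eps, eps[] ([occupation_near0]), and by right-continuity this
    time is bounded by the number of visits along fine grids
    ([visits_lt_count]).  The exponential moments of this number of visits are
    computed by expanding a product over the visits: since increments are
    independent, a return after [k] steps of length [dt] costs a factor
    [P (`|X (k dt)| < 2 eps)] ([hit_weight_return]), which is at most
    [C eps (k dt)^(- 1/alpha)] ([small_ball]) because the characteristic function
    of [X r] decays like [exp (- r `|xi|^alpha / chi)].  The outcome is a discrete
    renewal inequality, solved by discounting the steps at rate [lam]
    ([renewal_bound]). *)

Set Implicit Arguments.
Unset Strict Implicit.
Unset Printing Implicit Defensive.

Import Order.TTheory GRing.Theory Num.Theory.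
Import numFieldNormedType.Exports.

Local Open Scope classical_set_scope.
Local Open Scope ring_scope.

(** * Elementary inequalities *)

Section RealSums.
Context {R : realType}.
Implicit Types (x y mu g q : R).

(** Concavity of [x `^ (1 - g)], from the weighted arithmetic-geometric inequality. *)
Lemma powR_tangent g mu y : 0 < g < 1 -> 0 <= mu -> mu <= y -> 0 < y ->
  mu * y `^ (- g) <= (y `^ (1 - g) - (y - mu) `^ (1 - g)) / (1 - g).
Proof.
move=> /andP[g0 g1] mu0 muy y0.
have b0 : 0 < 1 - g by lra.
have amgm : (y - mu) `^ (1 - g) * y `^ g <= (1 - g) * (y - mu) + g * y.
  have := @conjugate_powR R ((y - mu) `^ (1 - g)) (y `^ g) (1 - g)^-1 g^-1.
  rewrite !powR_ge0 !invr_gt0 !invrK -!powRrM !divff ?gt_eqF// => /(_ isT isT b0 g0).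
  rewrite !powRr1 ?subr_ge0 ?(ltW y0)//.
  by rewrite subrK => /(_ erefl); rewrite mulrC [_ * g]mulrC [(y - mu) * _]mulrC mulrC.
rewrite ler_pdivlMr//.
have yg : 0 < y `^ g by rewrite powR_gt0.
rewrite -(ler_pM2r yg) mulrBl -powRD; last by rewrite (gt_eqF y0) implybT.
rewrite subrK powRr1 ?(ltW y0)// powRN.
rewrite mulrAC -[mu * _ * _]mulrA mulVf ?gt_eqF// mulr1.
nra.
Qed.

(** A telescoping majorant that needs no case distinction when it is summed:
    its first part only grows up to [1], where it controls [x `^ (- g)], and
    its second part controls the exponential tail beyond [1]. *)
Lemma powR_expR_term_le g mu (k : nat) : 0 < g < 1 -> 0 < mu ->
  let c (j : nat) := Num.min (j%:R * mu) 1 `^ (1 - g) / (1 - g)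
                     - expR (- (j%:R * mu)) in
  mu * ((k.+1%:R * mu) `^ (- g) * expR (- (k.+1%:R * mu))) <= c k.+1 - c k.
Proof.
move=> g01 mu0; have /andP[g0 g1] := g01; cbv zeta.
set y := k.+1%:R * mu.
have y0 : 0 < y by rewrite mulr_gt0.
have ky : k%:R * mu = y - mu by rewrite /y -natr1 mulrDl mul1r addrK.
have muy : mu <= y by rewrite -subr_ge0 -ky mulr_ge0// ltW.
have b0 : 0 < 1 - g by lra.
rewrite ky -/y.
have [y1|y1] := leP y 1.
  have -> : Num.min (y - mu) 1 = y - mu by rewrite min_l//; lra.
  have h : mu * (y `^ (- g) * expR (- y)) <= mu * y `^ (- g).
    rewrite ler_pM2l// ler_piMr ?powR_ge0// -expR0 ler_expR; lra.
  have := powR_tangent g01 (ltW mu0) muy y0; rewrite mulrBl => h2.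
  have h3 : expR (- y) <= expR (- (y - mu)) by rewrite ler_expR; lra.
  by lra.
have h0 : Num.min (y - mu) 1 `^ (1 - g) <= 1 `^ (1 - g).
  apply: ge0_ler_powR; rewrite ?nnegrE ?(ltW b0)//.
    by rewrite le_min ler01 subr_ge0 muy.
  by rewrite ge_min lexx orbT.
have h1 : Num.min (y - mu) 1 `^ (1 - g) / (1 - g) <= 1 `^ (1 - g) / (1 - g).
  by rewrite ler_pM2r ?invr_gt0.
have h2 : mu * (y `^ (- g) * expR (- y)) <= mu * expR (- y).
  rewrite ler_pM2l// ler_piMl ?expR_ge0//.
  by rewrite -(powRr0 y) ler_powR ?ltW//; lra.
have h3 : mu * expR (- y) <= expR (- (y - mu)) - expR (- y).
  have -> : - (y - mu) = mu + - y by lra.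
  rewrite expRD.
  by have := expR_ge1Dx mu; have := expR_gt0 (- y); nra.
by lra.
Qed.

(** The Riemann sum of mesh [mu] of the integrable function [x^(-g) e^(-x)]; the
    bound is uniform in the number of terms. *)
Lemma sum_powR_expR_le g mu (M : nat) : 0 < g < 1 -> 0 < mu ->
  \sum_(k < M) (k.+1%:R * mu) `^ (- g) * expR (- (k.+1%:R * mu))
    <= ((1 - g)^-1 + 1) / mu.
Proof.
move=> g01 mu0; have /andP[g0 g1] := g01.
rewrite ler_pdivlMr// mulrC mulr_sumr.
pose c (j : nat) := Num.min (j%:R * mu) 1 `^ (1 - g) / (1 - g)
                     - expR (- (j%:R * mu)).
have : \sum_(k < M) mu * ((k.+1%:R * mu) `^ (- g) * expR (- (k.+1%:R * mu)))
   <= c M - c 0%N.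
  rewrite -(telescope_sumr c (leq0n M)) big_mkord.
  by apply: ler_sum => k _; exact: powR_expR_term_le.
move=> /le_trans; apply.
have -> : c 0%N = -1.
  rewrite /c mul0r oppr0 expR0 min_l ?ler01// powR0 ?mul0r ?sub0r//.
  by rewrite subr_eq0 gt_eqF.
rewrite /c opprK.
have : Num.min (M%:R * mu) 1 `^ (1 - g) / (1 - g) <= (1 - g)^-1.
  rewrite ler_piMl ?invr_ge0 ?subr_ge0 ?(ltW g1)//.
  rewrite -[leRHS](_ : 1 `^ (1 - g) = 1); last by rewrite powR1.
  rewrite ge0_ler_powR ?nnegrE// ?ler01//; first lra.
    by rewrite le_min ler01 mulr_ge0 ?(ltW mu0).
  by rewrite ge_min lexx orbT.
by have := expR_ge0 (- (M%:R * mu)); lra.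
Qed.

Definition natdist (j k : nat) : nat := (j - k) + (k - j).

Lemma sum_geometric_le q (n : nat) : 0 <= q < 1 ->
  \sum_(i < n) q ^+ i <= (1 - q)^-1.
Proof.
move=> /andP[q0 q1].
rewrite -[leRHS]mul1r ler_pdivlMr ?subr_gt0//.
have -> : (\sum_(i < n) q ^+ i) * (1 - q) = 1 - q ^+ n.
  have := subrX1 q n; rewrite mulrC; lra.
by have := exprn_ge0 n q0; lra.
Qed.

Lemma sum_geometric_dist_le q (N : nat) : 0 <= q < 1 ->
  \sum_(j < N) \sum_(k < N) q ^+ natdist j k <= N%:R * (2 / (1 - q)).
Proof.
move=> q01; elim: N => [|N IH]; first by rewrite big_ord0 mul0r.
have /andP[q0 q1] := q01.
rewrite big_ord_recr/=.
under eq_bigr do rewrite big_ord_recr/=.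
rewrite big_split/= -natr1 mulrDl mul1r -addrA lerD//.
have e : \sum_(i < N) q ^+ natdist i N = \sum_(i < N) q ^+ i.+1.
  rewrite (reindex_inj rev_ord_inj)/=; apply: eq_bigr => i _; congr (_ ^+ _).
  by rewrite /natdist; have := ltn_ord i; lia.
have e' : \sum_(i < N.+1) q ^+ natdist N i = \sum_(i < N.+1) q ^+ i.
  rewrite (reindex_inj rev_ord_inj)/=; apply: eq_bigr => i _; congr (_ ^+ _).
  by rewrite /natdist; have := ltn_ord i; lia.
rewrite e e'.
have := sum_geometric_le N.+1 q01.
have : \sum_(i < N) q ^+ i.+1 <= (1 - q)^-1.
  apply: le_trans (sum_geometric_le N q01); apply: ler_sum => i _.
  by rewrite exprS ler_piMl ?exprn_ge0// ltW.
lra.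
Qed.

Lemma sum_convolution_le (f g : nat -> R) M :
  (forall i, 0 <= f i) -> (forall i, 0 <= g i) ->
  \sum_(j < M) \sum_(i < j) f (j - i)%N * g i <=
    (\sum_(k < M) f k.+1) * (\sum_(i < M) g i).
Proof.
move=> f0 g0.
under eq_bigr do
  rewrite (big_ord_widen M (fun i => f (_ - i)%N * g i) (ltnW (ltn_ord _))).
rewrite (exchange_big_dep xpredT)//= mulr_sumr; apply: ler_sum => i _.
rewrite -mulr_suml ler_wpM2r//.
rewrite -(big_geq_mkord i.+1 M xpredT (fun j => f (j - i)%N))/=.
rewrite -add1n big_addn big_add1 big_mkord.
rewrite [leLHS](eq_bigr (fun k : 'I__ => f k.+1)); last first.
  by move=> k _; congr f; lia.
rewrite [leLHS](big_ord_widen M (fun k => f k.+1)); last by lia.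
rewrite [leRHS](bigID (fun k : 'I_M => (k < (M - i).-1)%N))/=.
by rewrite lerDl sumr_ge0.
Qed.

(** The double sum is the squared modulus of [sum_j e^(i j t)]. *)
Lemma sum_cos_ge0 (N : nat) (t : R) :
  0 <= \sum_(j < N) \sum_(k < N) cos ((j%:R - k%:R) * t).
Proof.
have -> : \sum_(j < N) \sum_(k < N) cos ((j%:R - k%:R) * t) =
    (\sum_(j < N) cos (j%:R * t)) ^+ 2 + (\sum_(j < N) sin (j%:R * t)) ^+ 2.
  rewrite !expr2 !big_distrlr/= -big_split/=; apply: eq_bigr => j _.
  rewrite -big_split/=; apply: eq_bigr => k _.
  by rewrite mulrBl cosB.
by rewrite addr_ge0// sqr_ge0.
Qed.

Lemma cos_ge_cos1 (x : R) : `|x| <= 1 -> cos 1 <= cos x.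
Proof.
move=> x1; have -> : cos x = cos `|x|.
  by have [|] := ger0P x => // _; rewrite cosN.
have p2 := @pi_ge2 R.
move: x1; rewrite le_eqVlt => /predU1P[->//|x1].
by rewrite ltW// ltr_cos ?in_itv/= ?normr_ge0//=; lra.
Qed.

Lemma expR_half_le (x : R) : 0 <= x <= 1 -> expR (x / 2) <= 1 + x.
Proof.
move=> /andP[x0 x1]; have := expR_ge1Dx (- (x / 2)); rewrite expRN => h.
have e0 := expR_gt0 (x / 2).
have : (1 - x / 2) * expR (x / 2) <= 1 by rewrite -ler_pdivlMr// div1r.
nra.
Qed.

Lemma inv_small (h e : R) : 0 < h -> 0 < e ->
  exists m, forall M, (m <= M)%N -> h / M.+1%:R < e.
Proof.
move=> h0 e0; exists (Num.truncn (h / e)).+1 => M mM.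
have /andP[_ h1] := truncn_itv (divr_ge0 (ltW h0) (ltW e0)).
rewrite ltr_pdivrMr// -ltr_pdivrMl// mulrC (lt_trans h1)// ltr_nat ltnS; exact: mM.
Qed.

Lemma expR_neg2_le (n : nat) : expR (- (2 * n.+1%:R)) <= 4^-1 ^+ n :> R.
Proof.
have e2 : 4 <= expR 2 :> R.
  have -> : 2 = 1 + 1 :> R by [].
  by rewrite expRD; have := expR_ge1Dx (1 : R); nra.
have e4 : expR (- 2) <= 4^-1 :> R.
  by rewrite expRN lef_pV2 ?posrE ?expR_gt0.
rewrite mulrC -mulrN expRM_natl.
apply: (@le_trans _ _ (4^-1 ^+ n.+1)); first by rewrite lerXn2r ?nnegrE ?expR_ge0.
by rewrite exprS ler_piMl ?exprn_ge0//; lra.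
Qed.

Lemma dyadic_bracket (x : R) : 0 < x <= 1 ->
  exists n, (2 ^+ n.+1)^-1 < x <= (2 ^+ n)^-1.
Proof.
move=> /andP[x0 x1].
have exQ : exists k, (2 ^+ k)^-1 < x.
  have [m hm] := inv_small ltr01 x0; exists m.
  apply: le_lt_trans (hm m (leqnn _)); rewrite div1r.
  by rewrite lef_pV2 ?posrE ?exprn_gt0// -natrX ler_nat ltn_expl.
case: (ex_minnP exQ) => -[|k] hk kmin.
  by move: hk; rewrite expr0 invr1 ltNge x1.
exists k; rewrite hk/= leNgt; apply/negP => h; have := kmin k h; lia.
Qed.

Lemma dyadic_bracket_ge (x : R) n N :
  (2 ^+ n.+1)^-1 < x -> x <= (2 ^+ N)^-1 -> (N <= n)%N.
Proof.
move=> h1 h2; have := lt_le_trans h1 h2.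
rewrite ltf_pV2 ?posrE ?exprn_gt0// -!natrX ltr_nat ltn_exp2l//.
Qed.

End RealSums.

(** * Small balls for stable variables *)

Section RealProbability.
Context {d : measure_display} {T : measurableType d} {R : realType}.
Variable P : probability T R.

Definition prob (A : set T) : R := fine (P A).

Lemma probE A : measurable A -> P A = (prob A)%:E.
Proof. by move=> mA; rewrite /prob fineK// fin_num_measure. Qed.

Lemma prob_ge0 A : 0 <= prob A.
Proof. by rewrite /prob fine_ge0. Qed.

Lemma prob_le1 A : measurable A -> prob A <= 1.
Proof. by move=> mA; rewrite -lee_fin -probE// probability_le1. Qed.

Lemma probT : prob setT = 1.
Proof. by rewrite /prob probability_setT. Qed.

Lemma le_prob A B : measurable A -> measurable B -> A `<=` B -> prob A <= prob B.
Proof. by move=> mA mB AB; rewrite -lee_fin -!probE// le_measure ?inE. Qed.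

Lemma prob_split A B : measurable A -> measurable B ->
  prob A = prob (A `&` B) + prob (A `&` ~` B).
Proof.
move=> mA mB; have mAB := measurableI _ _ mA mB.
have mAC := measurableI _ _ mA (measurableC mB).
apply: EFin_inj; rewrite EFinD -!probE//.
rewrite -[in LHS](setIT A) -(setUv B) setIUr measureU//.
by rewrite setIACA setICr setI0.
Qed.

Lemma measurable_abs_lt (f : T -> R) eps : measurable_fun setT f ->
  measurable [set w | `|f w| < eps].
Proof.
move=> mf; have -> : [set w | `|f w| < eps] = f @^-1` `]- eps, eps[.
  by apply/seteqP; split => w; rewrite /= in_itv/= ltr_norml.
by rewrite -[X in measurable X]setTI; exact: mf.
Qed.

Lemma measurable_gt (f : T -> R) y : measurable_fun setT f ->
  measurable [set w | y < f w].
Proof.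
move=> mf; have -> : [set w | y < f w] = f @^-1` `]y, +oo[.
  by apply/seteqP; split => w; rewrite /= in_itv/= andbT.
by rewrite -[X in measurable X]setTI; exact: mf.
Qed.

Lemma bounded_integrable (f : T -> R) (M : R) : measurable_fun setT f ->
  (forall w, `|f w| <= M) -> P.-integrable setT (EFin \o f).
Proof.
move=> mf fM; apply: measurable_bounded_integrable => //.
  by rewrite -ge0_fin_numE// fin_num_measure.
by exists M; split; [exact: num_real|move=> x Mx w _; exact: le_trans (fM w) (ltW Mx)].
Qed.

End RealProbability.

Section SmallBall.
Context {d : measure_display} {T : measurableType d} {R : realType}.
Variable P : probability T R.

(** A form of Esseen's inequality: decay of the characteristic function bounds
    the mass of small balls.  For nodes [j a], [j < N], of mesh
    [a = r `^ (- alpha^-1)], the double sum of [cos ((j - k) a Y)] is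
    nonnegative, is at least [N^2 cos 1] as soon as [N a `|Y| <= 1], and has an
    expectation of order [N] only, because [r `|(j - k) a| `^ alpha] is at least
    [`|j - k|]. *)
Lemma small_ball (alpha chi r eps : R) (Y : {RV P >-> R}) :
  1 < alpha -> 0 < chi -> 0 < r -> 0 < eps ->
  (forall xi, 'E_P[fun w => cos (xi * Y w)] <=
      (expR (- (r * `|xi| `^ alpha) / chi))%:E)%E ->
  fine (P [set w | `|Y w| < eps]) <=
    4 / ((1 - expR (- chi^-1)) * cos 1) * (eps * r `^ (- alpha^-1)).
Proof.
move=> alpha1 chi0 r0 eps0 hE.
set q := expR (- chi^-1); set a := r `^ (- alpha^-1).
have q01 : 0 <= q < 1 by rewrite expR_ge0 -expR0 ltr_expR oppr_lt0 invr_gt0.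
have /andP[q0 q1] := q01.
have q1' : 0 < 1 - q by lra.
have c1 := @cos1_gt0 R.
have a0 : 0 < a by rewrite powR_gt0.
have cos1le : cos 1 <= 1 :> R := cos_le1 _.
have mY : measurable_fun setT Y by exact: measurable_funP.
have mA : measurable [set w | `|Y w| < eps] by exact: measurable_abs_lt.
have cq0 : 0 < (1 - q) * cos 1 by rewrite mulr_gt0.
(* when [1 <= eps * a] the right-hand side is at least [1] *)
have [ea|ea] := leP 1 (eps * a).
  rewrite (le_trans (prob_le1 P mA))//.
  have : 1 <= 4 / ((1 - q) * cos 1) by rewrite ler_pdivlMr//; nra.
  by move=> h; rewrite -[leLHS]mulr1 ler_pM.
(* the largest [N] for which [N a eps <= 1], within a factor [2] of equality *)
pose N := Num.truncn (eps * a)^-1.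
have ea0 : 0 < eps * a by rewrite mulr_gt0.
have /andP[N1 N2] : N%:R <= (eps * a)^-1 < N.+1%:R.
  by apply: truncn_itv; rewrite invr_ge0 ltW.
have Nge1 : 1 <= N%:R :> R.
  rewrite ler1n lt0n; apply/eqP => N0; move: N2; rewrite N0.
  by apply/negP; rewrite -leNgt invf_ge1// ltW.
have N0 : 0 < N%:R :> R by lra.
have Nle : N%:R * (eps * a) <= 1 by rewrite -ler_pdivlMr// mul1r.
have Nge : 1 <= 2 * (N%:R * (eps * a)).
  move: N2; rewrite -[X in X < _]div1r ltr_pdivrMr// -natr1 => N2; nra.
pose F (jk : 'I_N * 'I_N) (w : T) : R := cos ((jk.1%:R - jk.2%:R) * a * Y w).
have mF jk : measurable_fun setT (F jk).
  apply: measurableT_comp; first exact: (continuous_measurable_fun (@continuous_cos R)).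
  exact: measurable_funM.
have iF jk : P.-integrable setT (EFin \o F jk).
  apply: (@bounded_integrable _ _ _ P _ 1) => // w.
  by rewrite ler_norml cos_geN1 cos_le1.
have lowerb w : cos 1 * N%:R ^+ 2 * \1_[set w | `|Y w| < eps] w <=
    \sum_(jk : 'I_N * 'I_N) F jk w.
  rewrite indicE; have [/set_mem/= Yw|_] := boolP (w \in _); last first.
    rewrite mulr0 -(pair_bigA _ (fun j k => F (j, k) w))/= /F/=.
    under eq_bigr do under eq_bigr do rewrite -mulrA.
    exact: sum_cos_ge0.
  rewrite mulr1 mulrC.
  have -> : N%:R ^+ 2 * cos 1 = \sum_(jk : 'I_N * 'I_N) cos 1 :> R.
    have cN : #|{: 'I_N * 'I_N}| = (N * N)%N by rewrite card_prod card_ord.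
    by rewrite sumr_const cN -[RHS]mulr_natl natrM expr2.
  apply: ler_sum => -[j k] _; rewrite /F/=; apply: cos_ge_cos1.
  rewrite !normrM (gtr0_norm a0).
  have jkN : `|j%:R - k%:R| <= N%:R :> R.
    rewrite ler_norml; have jN : j%:R <= N%:R :> R by rewrite ler_nat ltnW.
    have kN : k%:R <= N%:R :> R by rewrite ler_nat ltnW.
    have := ler0n R j; have := ler0n R k; lra.
  apply: le_trans Nle; rewrite -mulrA ler_pM// ?mulr_ge0 ?(ltW a0)//.
  by rewrite mulrC ler_pM2r// ltW.
have upperb : (\int[P]_w (\sum_(jk : 'I_N * 'I_N) (F jk w)%:E)
    <= (\sum_(jk : 'I_N * 'I_N) q ^+ natdist jk.1 jk.2)%:E)%E.
  rewrite integral_sum//.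
  rewrite -sumEFin; apply: lee_sum => -[j k] _ /=.
  have := hE ((j%:R - k%:R) * a); rewrite unlock => /le_trans; apply.
  rewrite lee_fin /q -expRM_natl ler_expR mulNr mulrN lerN2.
  rewrite ler_pM2r ?invr_gt0// normrM (gtr0_norm a0) powRM ?(ltW a0)//.
  rewrite /a -powRrM mulNr mulVf ?gt_eqF//; last by lra.
  rewrite powR_inv1 ?(ltW r0)// mulrCA divff ?gt_eqF// mulr1.
  have -> : `|j%:R - k%:R| = (natdist j k)%:R :> R.
    rewrite /natdist; have [jk|/ltnW jk] := leqP j k.
      rewrite (eqP jk) add0n natrB// distrC ger0_norm ?subr_ge0 ?ler_nat//.
    by rewrite (eqP jk) addn0 natrB// ger0_norm ?subr_ge0 ?ler_nat.
  have [->|n0] := posnP (natdist j k).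
    by rewrite powR_ge0.
  by rewrite le1r_powR ?ler1n ?ltW.
have dom : (\int[P]_w (cos 1 * N%:R ^+ 2 * \1_[set w | `|Y w| < eps] w)%:E <=
    \int[P]_w (\sum_(jk : 'I_N * 'I_N) (F jk w)%:E))%E.
  apply: le_integral => //.
  - apply: (@bounded_integrable _ _ _ P _ (cos 1 * N%:R ^+ 2)) => [|w].
      by apply: measurable_funM => //; exact: measurable_indic.
    rewrite normrM ger0_norm ?mulr_ge0 ?(ltW c1) ?exprn_ge0// ler_piMr//.
      by rewrite ?mulr_ge0 ?(ltW c1) ?exprn_ge0.
    by rewrite indicE; case: (_ \in _); rewrite ?normr1 ?normr0 ?ler01.
  - by apply: integrable_sum => // jk _; exact: iF.
  - by move=> w _; rewrite sumEFin lee_fin.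
have key : cos 1 * N%:R ^+ 2 * prob P [set w | `|Y w| < eps] <= N%:R * (2 / (1 - q)).
  apply: le_trans (sum_geometric_dist_le N q01).
  rewrite pair_bigA/= -lee_fin; apply: le_trans upperb; apply: le_trans dom.
  under eq_integral do rewrite EFinM.
  rewrite ge0_integralZl//; last 2 first.
  - by apply/measurable_EFinP; exact: measurable_indic.
  - by rewrite lee_fin mulr_ge0 ?(ltW c1) ?exprn_ge0.
  by rewrite integral_indic// setIT EFinM -probE.
rewrite -/(prob P _) mulrAC ler_pdivlMr//.
set p := prob P _ in key *.
have p0 : 0 <= p := prob_ge0 _ _.
have key2 : cos 1 * N%:R * p <= 2 / (1 - q).
  by rewrite -(ler_pM2l N0); apply: le_trans key; rewrite expr2; lra.
move: key2; rewrite ler_pdivlMr// => key2.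
have h : p * ((1 - q) * cos 1) <= 2 * (N%:R * (eps * a)) * (p * ((1 - q) * cos 1)).
  by rewrite ler_peMl// mulr_ge0// ltW.
apply: le_trans h _.
have -> : 2 * (N%:R * (eps * a)) * (p * ((1 - q) * cos 1)) =
  2 * (eps * a) * (cos 1 * N%:R * p * (1 - q)) by ring.
have : 2 * (eps * a) * (cos 1 * N%:R * p * (1 - q)) <= 2 * (eps * a) * 2.
  by rewrite ler_pM2l// mulr_gt0.
by lra.
Qed.

End SmallBall.

Section StableChar.
Context {R : realType}.

Lemma Re_stable_char_fun (alpha nu chi t xi : R) : 0 < chi ->
  complex.Re (stable_char_fun alpha nu chi t xi) <=
    expR (- (t * `|xi| `^ alpha) / chi).
Proof.
move=> chi0; rewrite /stable_char_fun.
set u := t * _; set v := _ * tan _.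
have -> : (- u%:C * ((1 +i* v) / chi%:C) = (- u / chi) +i* (- u * v / chi))%C.
  by simpc; apply/eqP; rewrite eq_complex/=; apply/andP; split; apply/eqP;
    rewrite ?expr0n ?addr0 /=; field; rewrite ?gt_eqF.
by rewrite /cexp /= ler_piMr ?expR_ge0// cos_le1.
Qed.

End StableChar.

Section StableSmallBall.
Context {d : measure_display} {T : measurableType d} {R : realType}.
Variable P : probability T R.

Definition small_ball_const (chi : R) : R := 4 / ((1 - expR (- chi^-1)) * cos 1).

Lemma small_ball_const_ge (chi : R) : 0 < chi -> 4^-1 <= small_ball_const chi.
Proof.
move=> chi0.
have q1 : expR (- chi^-1) < 1 by rewrite -expR0 ltr_expR oppr_lt0 invr_gt0.
have q0 := expR_gt0 (- chi^-1).
have c1 := @cos1_gt0 R.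
have cle1 : cos 1 <= 1 :> R := cos_le1 _.
have den0 : 0 < (1 - expR (- chi^-1)) * cos 1 by rewrite mulr_gt0 ?subr_gt0.
by rewrite /small_ball_const ler_pdivlMr//; nra.
Qed.

Lemma stable_small_ball (alpha nu chi : R) (X : R -> {RV P >-> R}) :
  1 < alpha -> 0 < chi -> stable_levy_process alpha nu chi X ->
  forall r eps : R, 0 < r -> 0 < eps ->
  prob P [set w | `|X r w| < eps] <= small_ball_const chi * (eps * r `^ (- alpha^-1)).
Proof.
move=> alpha1 chi0 stableX r eps r0 eps0; apply: small_ball => // xi.
have mc : measurable_fun setT (fun w => cos (xi * X r w)).
  apply: measurableT_comp; first exact: (continuous_measurable_fun (@continuous_cos R)).
  by apply: measurable_funM => //; exact: measurable_funP.
have ic : P.-integrable setT (EFin \o (fun w => cos (xi * X r w))).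
  apply: (@bounded_integrable _ _ _ P _ 1) => // w.
  by rewrite ler_norml cos_geN1 cos_le1.
have fE : ('E_P[fun w => cos (xi * X r w)] \is a fin_num)%E.
  by rewrite unlock; exact: integrable_fin_num.
rewrite -(fineK fE) lee_fin; apply: le_trans (Re_stable_char_fun alpha nu r xi chi0).
by rewrite -(stable_char stableX xi (ltW r0)).
Qed.

End StableSmallBall.

(** * Exponential moments of a number of events *)

Section HitCount.
Context {d : measure_display} {T : measurableType d} {R : realType}.
Variable P : probability T R.
Variables (a : R) (E : nat -> set T).

(** The expectation of [\1_A * \prod_(i < n) (1 + a * \1_(E i))], that is of
    [\1_A * (1 + a) ^+ hits n], expanded into probabilities of intersections so
    that its properties follow by induction without any integration. *)
Fixpoint hit_weight (n : nat) (A : set T) : R :=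
  if n is m.+1 then hit_weight m A + a * hit_weight m (A `&` E m)
  else prob P A.

(** Expanding the product, the terms are sorted according to the last event
    that they select. *)
Lemma hit_weight_last n A :
  hit_weight n A = prob P A + a * \sum_(i < n) hit_weight i (A `&` E i).
Proof.
elim: n => [|n IH] /=; first by rewrite big_ord0 mulr0 addr0.
by rewrite big_ord_recr/= IH; ring.
Qed.

(** In the application [K] is the sigma-algebra of the past and [B] an event of
    the future. *)
Lemma hit_weight_indep (K : set (set T)) (B : set T) n A :
  (forall C D, K C -> K D -> K (C `&` D)) ->
  (forall i, (i < n)%N -> K (E i)) ->
  (forall C, K C -> prob P (B `&` C) = prob P B * prob P C) ->
  K A -> hit_weight n (B `&` A) = prob P B * hit_weight n A.
Proof.
move=> KI; elim: n A => [|n IH] A KE KP KA /=; first exact: KP.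
have KE' i : (i < n)%N -> K (E i) by move=> h; apply: KE; lia.
by rewrite -setIA !IH//; [ring|apply: KI => //; exact: KE].
Qed.

Definition hits (n : nat) (w : T) : nat := \sum_(i < n) (w \in E i).

Lemma hitsS n w : hits n.+1 w = (hits n w + (w \in E n))%N.
Proof. by rewrite /hits big_ord_recr. Qed.

Lemma lt_hitsE n (z : R) : 0 <= z ->
  [set w | z < (hits n w)%:R] = [set w | (Num.truncn z < hits n w)%N].
Proof.
move=> z0; have /andP[t1 t2] := truncn_itv z0.
apply/seteqP; split => w /= hw; last by rewrite (lt_le_trans t2)// ler_nat.
rewrite ltnNge; apply/negP => h'; move: hw; apply/negP; rewrite -leNgt.
by apply: le_trans t1; rewrite ler_nat.
Qed.

Hypothesis mE : forall i, measurable (E i).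

Lemma measurable_hits_ge m n : measurable [set w | (m <= hits n w)%N].
Proof.
elim: n m => [|n IH] m.
  have -> : [set w | (m <= hits 0 w)%N] = [set _ | (m <= 0)%N].
    by apply/seteqP; split => w; rewrite /= /hits big_ord0.
  by case: m => [|m]; rewrite ?set_true ?set_false.
have -> : [set w | (m <= hits n.+1 w)%N] =
    [set w | (m <= hits n w)%N] `|` ([set w | (m.-1 <= hits n w)%N] `&` E n).
  apply/seteqP; split => w /=; rewrite hitsS.
    case: (boolP (w \in E n)) => [/set_mem Ew|_]; rewrite ?addn0 => h.
      by right; split => //; lia.
    by left.
  by move=> [h|[h /mem_set ->]]; [lia|lia].
by apply: measurableU => //; apply: measurableI.
Qed.

Lemma hit_weight_split n A B : measurable A -> measurable B ->
  hit_weight n A = hit_weight n (A `&` B) + hit_weight n (A `&` ~` B).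
Proof.
elim: n A => [|n IH] A mA mB /=; first exact: prob_split.
rewrite (IH _ mA)// (IH (A `&` E n))//; last exact: measurableI.
rewrite [A `&` E n `&` B]setIAC [A `&` E n `&` ~` B]setIAC; ring.
Qed.

Hypothesis a0 : 0 <= a.

Lemma hit_weight_ge0 n A : 0 <= hit_weight n A.
Proof. by elim: n A => [|n IH] A /=; rewrite ?prob_ge0// addr_ge0// mulr_ge0. Qed.

Lemma le_hit_weight n A B : measurable A -> measurable B -> A `<=` B ->
  hit_weight n A <= hit_weight n B.
Proof.
elim: n A B => [|n IH] A B mA mB AB /=; first exact: le_prob.
rewrite lerD ?ler_wpM2l// IH//; try exact: measurableI.
exact: setSI.
Qed.

(** Markov's inequality for the variable [(1 + a) ^+ hits n]. *)
Lemma hit_weight_markov m n A : measurable A ->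
  (1 + a) ^+ m * prob P (A `&` [set w | (m <= hits n w)%N]) <= hit_weight n A.
Proof.
have a1 : 1 <= 1 + a by rewrite lerDl.
elim: n m A => [|n IH] m A mA /=.
  case: m => [|m].
    rewrite expr0 mul1r le_prob//; apply: measurableI => //; exact: measurable_hits_ge.
  have -> : A `&` [set w | (m.+1 <= hits 0 w)%N] = set0.
    by apply/seteqP; split => w //= [_]; rewrite /hits big_ord0.
  by rewrite /prob measure0 mulr0 fine_ge0.
set B := A `&` _.
have mB : measurable B by apply: measurableI => //; exact: measurable_hits_ge.
have mAE := measurableI _ _ mA (mE n).
have mAC := measurableI _ _ mA (measurableC (mE n)).
have Hin : (1 + a) ^+ m * prob P (B `&` E n) <= (1 + a) * hit_weight n (A `&` E n).
  case: m @B mB => [|m] B mB.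
    rewrite expr0 mul1r.
    have h := IH 0%N _ mAE; rewrite expr0 mul1r in h.
    apply: (@le_trans _ _ (hit_weight n (A `&` E n))); last first.
      by rewrite ler_peMl// hit_weight_ge0.
    apply: le_trans h; apply: le_prob => //.
    - exact: measurableI.
    - by apply: measurableI => //; exact: measurable_hits_ge.
    - by move=> w [[? _] ?]; split.
  rewrite exprS -mulrA ler_pM2l; last by lra.
  apply: le_trans (IH m _ mAE); rewrite ler_pM2l; last by rewrite exprn_gt0//; lra.
  apply: le_prob => //.
  - exact: measurableI.
  - by apply: measurableI => //; exact: measurable_hits_ge.
  - by move=> w [[Aw /=]] + Ew; rewrite hitsS mem_set//; split => //=; lia.
have Hout : (1 + a) ^+ m * prob P (B `&` ~` E n) <= hit_weight n (A `&` ~` E n).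
  apply: le_trans (IH m _ mAC); rewrite ler_pM2l; last by rewrite exprn_gt0//; lra.
  apply: le_prob => //.
  - by apply: measurableI => //; exact: measurableC.
  - by apply: measurableI => //; exact: measurable_hits_ge.
  - by move=> w [[Aw /=]] + Ew; rewrite hitsS memNset//; split => //=; lia.
rewrite (prob_split P mB (mE n)) (hit_weight_split n mA (mE n)); lra.
Qed.

(** A visit at step [j] after one at step [i] costs a factor [p (j - i)], so the
    weights [u j] of the last visit satisfy the renewal inequality
    [u j <= p j.+1 + a * \sum_(i < j) p (j - i) * u i].  Its generating function
    at [rho] is a convolution, bounded once [a] times the one of [p] is at most
    one half; undoing the discount costs [rho ^- M]. *)
Lemma renewal_bound (p : nat -> R) (rho : R) (M : nat) :
  0 < rho <= 1 -> (forall k, 0 <= p k) ->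
  (forall j, (j < M)%N -> prob P (E j) <= p j.+1) ->
  (forall i j, (i < j)%N -> (j < M)%N ->
     hit_weight i (E j `&` E i) <= p (j - i)%N * hit_weight i (E i)) ->
  a * (\sum_(k < M) rho ^+ k.+1 * p k.+1) <= 2^-1 ->
  hit_weight M setT <= 2 * rho ^- M.
Proof.
move=> /andP[r0 r1] p0 hE hEE hG.
set G := \sum_(k < M) _ in hG.
pose u j := hit_weight j (E j).
have u0 j : 0 <= u j by exact: hit_weight_ge0.
have hu j : (j < M)%N -> u j <= p j.+1 + a * \sum_(i < j) p (j - i)%N * u i.
  move=> jM; rewrite /u hit_weight_last lerD ?hE//.
  by rewrite ler_wpM2l// ler_sum// => i _; exact: hEE.
pose U := \sum_(j < M) rho ^+ j.+1 * u j.
have U0 : 0 <= U by apply: sumr_ge0 => j _; rewrite mulr_ge0// exprn_ge0// ltW.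
have hU : U <= G + a * (G * U).
  have : U <= \sum_(j < M) (rho ^+ j.+1 * p j.+1 +
      a * \sum_(i < j) (rho ^+ (j - i) * p (j - i)%N) * (rho ^+ i.+1 * u i)).
    apply: ler_sum => j _.
    apply: le_trans (_ : rho ^+ j.+1 *
      (p j.+1 + a * \sum_(i < j) p (j - i)%N * u i) <= _).
      by rewrite ler_wpM2l ?hu// exprn_ge0// ltW.
    rewrite mulrDr lerD// mulrCA ler_wpM2l// mulr_sumr.
    apply: ler_sum => i _.
    have -> : (j.+1 = (j - i) + i.+1)%N by have := ltn_ord i; lia.
    by rewrite exprD le_eqVlt; apply/orP; left; apply/eqP; ring.
  rewrite big_split/= -mulr_sumr => /le_trans; apply.
  rewrite lerD// ler_wpM2l//.
  apply: le_trans (sum_convolution_le (f := fun k => rho ^+ k * p k)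
    (g := fun i => rho ^+ i.+1 * u i) M _ _) _ => // i;
    by rewrite mulr_ge0// exprn_ge0// ltW.
have aU : a * U <= 1.
  have : a * U <= a * G + a * G * (a * U).
    by rewrite -(mulrA a G) -mulrDr ler_wpM2l// mulrCA.
  have : 0 <= a * U by rewrite mulr_ge0.
  nra.
rewrite hit_weight_last probT.
have rM : 0 < rho ^- M by rewrite invr_gt0 exprn_gt0.
have rM1 : 1 <= rho ^- M by rewrite invf_ge1 ?exprn_gt0// exprn_ile1// ltW.
have : a * \sum_(i < M) hit_weight i (setT `&` E i) <= rho ^- M * (a * U).
  rewrite mulrCA ler_wpM2l// mulr_sumr; apply: ler_sum => i _.
  rewrite setTI mulrA ler_peMl ?u0//.
  by rewrite mulrC ler_pdivlMr ?exprn_gt0// mul1r ler_wiXn2l// ltW.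
have : rho ^- M * (a * U) <= rho ^- M by rewrite ler_piMr// ltW.
lra.
Qed.

End HitCount.

(** * Independence of the past and the next increment *)

Section IndependentIncrements.
Context {d : measure_display} {T : measurableType d} {R : realType}.
Variable P : probability T R.

Definition rectangles n (g : 'I_n -> T -> R) : set (set T) :=
  [set A | exists2 B : 'I_n -> set R, (forall i, measurable (B i)) &
     A = \bigcap_(i in [set: 'I_n]) (g i @^-1` B i)].

Lemma setI_closed_rectangles n (g : 'I_n -> T -> R) : setI_closed (rectangles g).
Proof.
move=> _ _ [B mB ->] [C mC ->]; exists (fun i => B i `&` C i).
  by move=> i; exact: measurableI.
by rewrite -bigcapI; apply: eq_bigcapr => i _; rewrite preimage_setI.
Qed.

(** The product rule, which mutual independence provides on rectangles, extends
    to the sigma-algebra that they generate by the pi-lambda theorem. *)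
Lemma indep_last n (f : 'I_n.+1 -> T -> R) (B : set R) (A : set T) :
  (forall i, measurable_fun setT (f i)) ->
  mutually_independent P f -> measurable B ->
  <<s rectangles (fun i : 'I_n => f (widen_ord (leqnSn n) i)) >> A ->
  measurable A /\
  prob P (f ord_max @^-1` B `&` A) = prob P (f ord_max @^-1` B) * prob P A.
Proof.
move=> mf indf mB.
set g := fun i : 'I_n => _; set F := f ord_max @^-1` B.
have mpre i C : measurable C -> measurable (f i @^-1` C).
  by move=> mC; rewrite -[X in measurable X]setTI; exact: mf.
have mF : measurable F by exact: mpre.
suff : <<s rectangles g >> `<=` [set A | measurable A /\ P (F `&` A) = (P F * P A)%E].
  move=> h /h [mA FA]; split => //.
  by apply: EFin_inj; rewrite EFinM -!probE//; exact: measurableI.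
apply: lambda_system_subset => //.
- exact: setI_closed_rectangles.
- apply/dynkin_lambda_system; split => //.
  + by split => //; rewrite setIT probability_setT mule1.
  + move=> C [mC FC]; split; first exact: measurableC.
    have mFC := measurableI _ _ mF mC; have mFC' := measurableI _ _ mF (measurableC mC).
    have mC' := measurableC mC.
    have h1 := prob_split P mF mC.
    have h2 := prob_split P measurableT mC; rewrite !setTI probT in h2.
    move: FC; rewrite !probE// -!EFinM => -[FC]; congr EFin; nra.
  + move=> G tG hG; have mG k : measurable (G k) by case: (hG k).
    split; first exact: bigcup_measurable.
    rewrite setI_bigcupr measure_bigcup//; last 2 first.
    * by move=> k _; exact: measurableI.
    * exact: trivIset_setIl.
    rewrite [in RHS]measure_bigcup// [P F in RHS](probE P mF) -nneseriesZl//.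
    by apply: eq_eseriesr => k _; case: (hG k) => _; rewrite (probE P mF).
- move=> _ [C mC ->]; split.
    by apply: fin_bigcap_measurable => // i _; exact: mpre.
(* the rectangle with [D] as its last side *)
pose ext D (i : 'I_n.+1) := if insub (val i) is Some j then C j else D.
have extw D j : ext D (widen_ord (leqnSn n) j) = C j by rewrite /ext /= valK.
have extm D : ext D ord_max = D by rewrite /ext /= insubF// ltnn.
have mext D i : measurable D -> measurable (ext D i).
  by move=> mD; rewrite /ext; case: insub.
have cap D : f ord_max @^-1` D `&` \bigcap_(i in [set: 'I_n]) (g i @^-1` C i) =
    \bigcap_(i in [set: 'I_n.+1]) (f i @^-1` ext D i).
  apply/seteqP; split => w /=.
    move=> [Dw h] i _ /=; case: (unliftP ord_max i) => [j ->|->]; last by rewrite extm.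
    have -> : lift ord_max j = widen_ord (leqnSn n) j.
      by apply: val_inj; exact: lift_max.
    by rewrite extw; exact: h.
  move=> h; split; first by have := h ord_max I; rewrite /= extm.
  by move=> j _; have := h (widen_ord (leqnSn n) j) I; rewrite /= extw.
have prodE D : measurable D ->
   P (f ord_max @^-1` D `&` \bigcap_(i in [set: 'I_n]) (g i @^-1` C i)) =
   ((\prod_(i < n) P (g i @^-1` C i)) * P (f ord_max @^-1` D))%E.
  move=> mD; rewrite cap indf; last by move=> i; exact: mext.
  rewrite big_ord_recr/= extm; congr (_ * _)%E.
  by apply: eq_bigr => i _; rewrite extw.
rewrite prodE// muleC; congr (_ * _)%E.
have := prodE setT measurableT.
by rewrite preimage_setT setTI probability_setT mule1 => ->.
Qed.

(** The positions of a process are partial sums of its increments, and each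
    increment is measurable since a rectangle may constrain a single side. *)
Lemma sum_sigma_rectangles n (g : 'I_n -> T -> R) (Q : pred 'I_n) (B : set R) :
  measurable B ->
  <<s rectangles g >> ((fun w => \sum_(i < n | Q i) g i w) @^-1` B).
Proof.
move=> mB.
have mg i : @measurable_fun _ _ (g_sigma_algebraType (rectangles g)) R setT (g i).
  move=> _ C mC; apply: sub_sigma_algebra.
  exists (fun j => if j == i then C else setT).
    by move=> j; case: ifP.
  rewrite setTI; apply/seteqP; split => w /=.
    by move=> Cw j _ /=; case: eqP => [->|].
  by move=> /(_ i I); rewrite /= eqxx.
have : @measurable_fun _ _ (g_sigma_algebraType (rectangles g)) R setT
   (fun w => \sum_(i < n | Q i) g i w).
  under eq_fun do rewrite big_mkcond/=.
  by apply: measurable_sum => i; case: (Q i).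
by move=> /(_ measurableT _ mB); rewrite setTI.
Qed.

Lemma sigma_rectanglesI n (g : 'I_n -> T -> R) A B :
  <<s rectangles g >> A -> <<s rectangles g >> B -> <<s rectangles g >> (A `&` B).
Proof.
move=> sA sB.
exact: (@measurableI _ (g_sigma_algebraType (rectangles g))).
Qed.

End IndependentIncrements.

(** * Visits of a Levy process along a grid *)

Section GridHits.
Context {d : measure_display} {T : measurableType d} {R : realType}.
Variable P : probability T R.
Variable X : R -> {RV P >-> R}.
Hypothesis levyX : levy_process X.
Variables (gamma C0 : R).
Hypotheses (gamma01 : 0 < gamma < 1) (C00 : 0 < C0).
Hypothesis smallX : forall r eps : R, 0 < r -> 0 < eps ->
  prob P [set w | `|X r w| < eps] <= C0 * (eps * r `^ (- gamma)).

Implicit Types (t dt eps lam y : R).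

Definition grid_visit t dt eps (k : nat) : set T :=
  [set w | `|X (t + dt * k.+1%:R) w - X 0 w| < eps].

Lemma measurable_incr s u : measurable_fun setT (fun w => X s w - X u w).
Proof. by apply: measurable_funB; exact: measurable_funP. Qed.
Local Hint Resolve measurable_incr : core.

Lemma prob_incr s u eps : 0 <= s -> s < u -> 0 < eps ->
  prob P [set w | `|X u w - X s w| < eps] <= C0 * (eps * (u - s) `^ (- gamma)).
Proof.
move=> s0 su eps0; apply: le_trans (smallX _ eps0); last by rewrite subr_gt0.
have e (f : T -> R) : [set w | `|f w| < eps] = f @^-1` `]- eps, eps[.
  by apply/seteqP; split => w; rewrite /= in_itv/= ltr_norml.
by rewrite /prob !e (levy_stationary levyX s0 (ltW su)).
Qed.

(** Visiting [`]-eps, eps[] at steps [i] and [j] forces the increment between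
    them to be less than [2 eps], and this increment is independent of the past
    of step [i]. *)
Lemma hit_weight_return t dt eps (a : R) i j (E := grid_visit t dt eps) :
  0 <= t -> 0 < dt -> 0 < eps -> 0 <= a ->
  (i < j)%N ->
  hit_weight P a E i (E j `&` E i) <=
    C0 * (2 * eps * ((j - i)%:R * dt) `^ (- gamma)) * hit_weight P a E i (E i).
Proof.
move=> t0 dt0 eps0 a0 ij.
have mE k : measurable (E k) by exact: measurable_abs_lt.
pose B := [set w | `|X (t + dt * j.+1%:R) w - X (t + dt * i.+1%:R) w| < 2 * eps].
have mB : measurable B by exact: measurable_abs_lt.
(* time [0], the grid up to step [i], then a single jump to step [j]: the last
   increment is the one of interest and the others span the past of step [i] *)
pose tau (k : nat) : R := if k == 0%N then 0 else
  if (k <= i.+1)%N then t + dt * k%:R else t + dt * j.+1%:R.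
have tau_incr k : tau k <= tau k.+1.
  rewrite /tau /=; case: k => [|k] /=.
    by rewrite addr_ge0// mulr_ge0// ltW.
  case: ifP => h1; case: ifP => h2 //.
  - by rewrite lerD2l ler_pM2l// ler_nat.
  - by rewrite lerD2l ler_pM2l// ler_nat; lia.
  - by exfalso; lia.
pose f (k : 'I_i.+2) w := X (tau k.+1) w - X (tau k) w.
have indf : mutually_independent P f .
  by apply: (levy_independent levyX) tau_incr; rewrite /tau.
pose K := <<s rectangles (fun k : 'I_i.+1 => f (widen_ord (leqnSn i.+1) k)) >>.
have KE k : (k <= i)%N -> K (E k).
  move=> ki; have -> : E k = (fun w => \sum_(l < i.+1 | (l < k.+1)%N)
       f (widen_ord (leqnSn i.+1) l) w) @^-1` `]- eps, eps[.
    apply/seteqP; split => w; rewrite /E /= in_itv/= -ltr_norml /f /=;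
    rewrite -(big_ord_widen _ (fun l => X (tau l.+1) w - X (tau l) w)) ?ltnS//;
    by rewrite -(big_mkord xpredT (fun l => X (tau l.+1) w - X (tau l) w))
      telescope_sumr// /tau /= ltnS ki.
  exact: sum_sigma_rectangles.
have KB C : K C -> prob P (B `&` C) = prob P B * prob P C.
  have -> : B = f ord_max @^-1` `]- (2 * eps), 2 * eps[.
    by apply/seteqP; split => w; rewrite /B /f /tau /= leqnn ltnn in_itv/= ltr_norml.
  move=> KC; case: (indep_last (B := `]- (2 * eps), 2 * eps[)
    (fun i => measurable_incr _ _) indf _ KC) => //.
have -> : (j - i)%:R * dt = t + dt * j.+1%:R - (t + dt * i.+1%:R) :> R.
  by rewrite natrB 1?ltnW// -!natr1; ring.
apply: (@le_trans _ _ (prob P B * hit_weight P a E i (E i))); last first.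
  rewrite ler_wpM2r ?hit_weight_ge0//; apply: prob_incr; last by rewrite mulr_gt0.
    by rewrite addr_ge0// mulr_ge0// ltW.
  by rewrite ltrD2l ltr_pM2l// ltr_nat.
rewrite -(@hit_weight_indep _ _ _ P a E K) //.
- apply: le_hit_weight => //; try exact: measurableI.
  move=> w [Ej Ei]; split => //; move: Ej Ei; rewrite /E /B /grid_visit /= => Ej Ei.
  have -> : X (t + dt * j.+1%:R) w - X (t + dt * i.+1%:R) w =
    (X (t + dt * j.+1%:R) w - X 0 w) - (X (t + dt * i.+1%:R) w - X 0 w) by ring.
  by rewrite (le_lt_trans (ler_normB _ _))//; lra.
- exact: sigma_rectanglesI.
- by move=> k ki; apply: KE; lia.
- exact: KE.
Qed.

(** The factor [4] combines the radius [2 eps] of the balls that returns fall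
    into with the bound one half that the renewal inequality requires. *)
Definition visit_const : R := 4 * C0 * ((1 - gamma)^-1 + 1).

Lemma visit_const_gt0 : 0 < visit_const.
Proof.
have /andP[g0 g1] := gamma01.
by rewrite /visit_const !mulr_gt0// addr_gt0// invr_gt0 subr_gt0.
Qed.

(** The renewal bound with discount [e^(- lam dt)] per step: the generating
    function of [C0 2 eps (k dt)^(- gamma)] is of order
    [eps / (dt lam^(1 - gamma))], and [a] is tuned to compensate it. *)
Lemma hits_exp_moment t dt eps lam (M : nat) :
  0 <= t -> 0 < dt -> 0 < eps -> 0 < lam ->
  hit_weight P (dt * lam `^ (1 - gamma) / (visit_const * eps)) (grid_visit t dt eps) M setT
    <= 2 * expR (lam * dt * M%:R).
Proof.
move=> t0 dt0 eps0 lam0; set a := dt * _ / _; set E := grid_visit t dt eps.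
have /andP[g0 g1] := gamma01.
have GC0 := visit_const_gt0.
have a0 : 0 <= a.
  apply: divr_ge0; apply: mulr_ge0; rewrite ?powR_ge0 ?(ltW dt0)//.
    exact: ltW.
  exact: ltW.
have mE k : measurable (E k) by exact: measurable_abs_lt.
have := @renewal_bound _ _ _ P a E a0
  (fun k => C0 * (2 * eps * (k%:R * dt) `^ (- gamma))) (expR (- (lam * dt))) M.
have -> : expR (- (lam * dt)) ^- M = expR (lam * dt * M%:R).
  by rewrite -expRM_natl -expRN mulrN opprK mulrC.
apply.
- by rewrite expR_gt0 -expR0 ler_expR oppr_le0 mulr_ge0// ltW.
- by move=> k; rewrite !mulr_ge0 ?powR_ge0 ?ltW.
- move=> j jM; apply: le_trans (prob_incr _ _ eps0) _ => //.
    by rewrite ltr_wpDl// mulr_gt0.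
  rewrite subr0 ler_pM2l// ler_pM ?powR_ge0 ?(ltW eps0)//; first by lra.
  rewrite !powRN lef_pV2 ?posrE ?powR_gt0 ?mulr_gt0// ?ltr_wpDl ?mulr_gt0//.
  rewrite ge0_ler_powR ?(ltW g0)// ?nnegrE ?addr_ge0 ?mulr_ge0 ?(ltW dt0)//.
  by rewrite mulrC lerDr.
- by move=> i j ij jM; exact: hit_weight_return.
pose mu := lam * dt.
have mu0 : 0 < mu by rewrite mulr_gt0.
have -> : \sum_(k < M) expR (- (lam * dt)) ^+ k.+1 *
      (C0 * (2 * eps * (k.+1%:R * dt) `^ (- gamma)))
  = C0 * (2 * eps) * lam `^ gamma *
    \sum_(k < M) (k.+1%:R * mu) `^ (- gamma) * expR (- (k.+1%:R * mu)).
  rewrite mulr_sumr; apply: eq_bigr => k _.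
  rewrite -expRM_natl mulrN -/mu.
  have -> : (k.+1%:R * dt) `^ (- gamma) = lam `^ gamma * (k.+1%:R * mu) `^ (- gamma).
    rewrite /mu (mulrCA k.+1%:R) (powRM _ (ltW lam0)); last by rewrite mulr_ge0// ltW.
    by rewrite mulrA -powRD ?subrr ?powRr0 ?mul1r// (gt_eqF lam0) implybT.
  by ring.
have := sum_powR_expR_le M gamma01 mu0.
set S := \sum_(k < M) _ => hS.
apply: (@le_trans _ _ (a * (C0 * (2 * eps) * lam `^ gamma *
  (((1 - gamma)^-1 + 1) / mu)))).
  rewrite ler_wpM2l// ler_wpM2l// !mulr_ge0 ?powR_ge0 ?(ltW C00) ?(ltW eps0)//.
have lg : lam `^ (1 - gamma) * lam `^ gamma = lam.
  by rewrite -powRD ?subrK ?powRr1 ?ltW// (gt_eqF lam0) implybT.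
rewrite le_eqVlt; apply/orP; left; apply/eqP.
rewrite /a /visit_const /mu.
have -> : forall u v : R, dt * u / (4 * C0 * ((1 - gamma)^-1 + 1) * eps) *
  (C0 * (2 * eps) * v * (((1 - gamma)^-1 + 1) / (lam * dt))) = (u * v) * 2^-1 / lam.
  move=> u v; field; rewrite !gt_eqF//; last by rewrite subr_gt0.
  by rewrite addr_gt0 ?ltr01 ?subr_gt0.
by rewrite lg mulrAC divff ?gt_eqF// mul1r.
Qed.

(** The threshold [2 eps y / dt] corresponds to an occupation time [2 eps y] of
    [`]-eps, eps[]; the bound depends on the grid only through its length
    [dt * M]. *)
Lemma hits_tail t dt eps lam y (M : nat) :
  0 <= t -> 0 < dt -> 0 < eps -> 0 < lam -> 0 <= y ->
  dt * lam `^ (1 - gamma) / (visit_const * eps) <= 1 ->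
  prob P [set w | 2 * eps * y / dt < (hits (grid_visit t dt eps) M w)%:R] <=
    2 * expR (lam * dt * M%:R - lam `^ (1 - gamma) * y / visit_const).
Proof.
move=> t0 dt0 eps0 lam0 y0; set a := dt * _ / _ => a1; set E := grid_visit t dt eps.
have /andP[g0 g1] := gamma01.
have GC0 := visit_const_gt0.
have a0 : 0 <= a.
  apply: divr_ge0; apply: mulr_ge0; rewrite ?powR_ge0 ?(ltW dt0)//.
    exact: ltW.
  exact: ltW.
have mE k : measurable (E k) by exact: measurable_abs_lt.
set z := 2 * eps * y / dt.
have z0 : 0 <= z by rewrite /z !mulr_ge0 ?invr_ge0 ?(ltW dt0) ?(ltW eps0).
pose m := (Num.truncn z).+1.
have zm : z < m%:R by have /andP[] := truncn_itv z0.
rewrite lt_hitsE// -/m.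
have hm := hit_weight_markov P mE a0 m M measurableT; rewrite setTI in hm.
have hM := hits_exp_moment M t0 dt0 eps0 lam0; rewrite -/a /= in hM.
set p := prob P _ in hm *.
have p0 : 0 <= p by exact: prob_ge0.
have am : expR (a * z / 2) <= (1 + a) ^+ m.
  apply: (@le_trans _ _ (expR (a / 2) ^+ m)).
    have : a * z <= a * m%:R by rewrite ler_wpM2l// ltW.
    by rewrite -expRM_natl ler_expR; lra.
  by rewrite lerXn2r ?nnegrE ?expR_ge0 ?addr_ge0// expR_half_le// a0 a1.
have -> : lam `^ (1 - gamma) * y / visit_const = a * z / 2.
  by rewrite /a /z; field; rewrite !gt_eqF.
rewrite expRD expRN mulrA ler_pdivlMr ?expR_gt0//.
rewrite mulrC; apply: le_trans hM; apply: le_trans hm.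
by rewrite ler_wpM2r.
Qed.

End GridHits.

(** * Occupation times and local time of a path *)

Definition right_continuous_path {R : realType} (x : R -> R) : Prop :=
  forall s : R, 0 <= s -> forall eta : R, 0 < eta ->
  exists2 e : R, 0 < e & forall s' : R, s <= s' < s + e -> `|x s' - x s| < eta.

Section OccupationOfPath.
Context {R : realType}.
Local Notation mu := (@lebesgue_measure R).
Variable x : R -> R.
Hypothesis rcx : right_continuous_path x.
Implicit Types (t h eps : R).

Definition visit_count t h eps (M : nat) : nat :=
  (\sum_(k < M) (`|x (t + h / M%:R * k.+1%:R)| < eps)%R)%N.

(** The points of [`]t, t + h]] whose grid point immediately to the right is a
    visit. *)
Definition visit_cells t h eps (M : nat) : set R :=
  \big[setU/set0]_(k < M) (if `|x (t + h / M%:R * k.+1%:R)| < eps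
    then `]t + h / M%:R * k%:R, t + h / M%:R * k.+1%:R]%classic else set0).

Lemma measurable_visit_cells t h eps M : measurable (visit_cells t h eps M).
Proof. by apply: bigsetU_measurable => k _; case: ifP. Qed.

Lemma visit_cells_le t h eps M : 0 < h ->
  (mu (visit_cells t h eps M) <= (h / M%:R * (visit_count t h eps M)%:R)%:E)%E.
Proof.
move=> h0.
pose F (k : nat) : set R := if `|x (t + h / M%:R * k.+1%:R)| < eps
    then `]t + h / M%:R * k%:R, t + h / M%:R * k.+1%:R]%classic else set0.
have mF k : measurable (F k) by rewrite /F; case: ifP.
apply: (@le_trans _ _ (\sum_(k < M) mu (F k))%E).
  exact: (Boole_inequality mu (fun i _ => mF i)).
rewrite /visit_count natr_sum mulr_sumr -sumEFin.
apply: lee_sum => k _; rewrite /F; case: ifP => _; last by rewrite measure0 mulr0.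
rewrite lebesgue_measure_itv/= lte_fin mulr1.
by case: ifP => _; rewrite -?EFinB lee_fin -?natr1; [lra|rewrite divr_ge0// ltW].
Qed.

Lemma visit_cellsP t h eps M s : 0 < h -> t < s <= t + h ->
  exists s', [/\ s <= s', s' <= s + h / M.+1%:R &
    visit_cells t h eps M.+1 s <-> `|x s'| < eps].
Proof.
move=> h0 /andP[ts sth]; set dt := h / M.+1%:R.
have dt0 : 0 < dt by rewrite divr_gt0.
pose Q k := s <= t + dt * k.+1%:R.
have exQ : exists k, Q k by exists M; rewrite /Q /dt divfK.
case: (ex_minnP exQ) => k Qk kmin.
have kM : (k < M.+1)%N by rewrite ltnS; apply: kmin; rewrite /Q /dt divfK.
have ks : t + dt * k%:R < s.
  case: k {Qk kM} kmin => [|k] kmin; first by rewrite mulr0 addr0.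
  rewrite ltNge; apply/negP => h1; have := kmin k h1; lia.
exists (t + dt * k.+1%:R); split => //.
  by rewrite -natr1 mulrDr mulr1 addrA lerD2r ltW.
rewrite /visit_cells -(bigcup_mkord M.+1 (fun k : nat =>
    if `|x (t + h / M.+1%:R * k.+1%:R)| < eps
    then `]t + h / M.+1%:R * k%:R, t + h / M.+1%:R * k.+1%:R]%classic
    else set0)) -/dt.
split=> [[l /= lM]|xk]; last first.
  by exists k => //=; rewrite xk /= in_itv/= ks.
case: ifP => //= xl; rewrite in_itv/= => /andP[ls sl].
suff -> : k = l by [].
apply/eqP; rewrite eqn_leq; apply/andP; split; first exact: kmin.
have : t + dt * l%:R < t + dt * k.+1%:R by exact: lt_le_trans Qk.
by rewrite ltrD2l ltr_pM2l// ltr_nat ltnS.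
Qed.

(** The union over [m] of these sets is the lower limit of the sets of visited
    cells, which by right-continuity sits between the visits to [`]-eps, eps[]
    and to its closure. *)
Definition eventual_cells t h eps (m : nat) : set R :=
  \bigcap_(M in [set M | (m <= M)%N]) visit_cells t h eps M.+1.

Lemma measurable_eventual_cells t h eps m : measurable (eventual_cells t h eps m).
Proof. by apply: bigcap_measurableType => M _; exact: measurable_visit_cells. Qed.

Lemma eventual_cells_sup t h eps s : 0 <= t -> 0 < h -> t < s <= t + h ->
  `|x s| < eps -> exists m, eventual_cells t h eps m s.
Proof.
move=> t0 h0 tsh xs; have /andP[ts sth] := tsh.
have s0 : 0 <= s by lra.
have [||e e0 he] := @rcx s _ (eps - `|x s|); rewrite ?subr_gt0//.
have [m hm] := inv_small h0 e0; exists m => M /= mM.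
have [s' [ss' s's visitE]] := visit_cellsP eps M h0 tsh; apply/visitE.
have xss' : `|x s' - x s| < eps - `|x s|.
  by apply: he; rewrite ss'/= (le_lt_trans s's)// ltrD2l hm.
by have := ler_normD (x s' - x s) (x s); rewrite subrK; lra.
Qed.

Lemma eventual_cells_inf t h eps s m : 0 <= t -> 0 < h -> t < s <= t + h ->
  eventual_cells t h eps m s -> `|x s| <= eps.
Proof.
move=> t0 h0 tsh hs; have /andP[ts sth] := tsh.
have s0 : 0 <= s by lra.
rewrite leNgt; apply/negP => xs.
have [||e e0 he] := @rcx s _ (`|x s| - eps); rewrite ?subr_gt0//.
have [m' hm] := inv_small h0 e0.
have [s' [ss' s's [+ _]]] := visit_cellsP eps (maxn m m') h0 tsh.
move=> /(_ (hs _ (leq_maxl _ _))) xs'.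
have xss' : `|x s' - x s| < `|x s| - eps.
  by apply: he; rewrite ss'/= (le_lt_trans s's)// ltrD2l hm// leq_maxr.
have := ler_normD (x s - x s') (x s'); rewrite subrK distrC; lra.
Qed.

Definition visits t h eps : set R := `]t, t + h] `&` [set s | `|x s| < eps].

Lemma measurable_visits t h eps : 0 <= t -> 0 < h -> measurable (visits t h eps).
Proof.
move=> t0 h0.
have -> : visits t h eps = `]t, t + h] `&`
    \bigcup_q \bigcup_m eventual_cells t h (eps - q.+1%:R^-1) m.
  apply/seteqP; split => s [] /=; rewrite in_itv/= => ts; last first.
    move=> [q _ [m _ /eventual_cells_inf]] => /(_ t0 h0 ts) xs.
    rewrite /visits; split => /=; first by rewrite in_itv.
    by rewrite (le_lt_trans xs)// ltrBlDr ltrDl invr_gt0.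
  move=> xs; split; first exact: ts.
  have [m hm] := @inv_small _ 1 (eps - `|x s|) ltr01 (ltac:(by rewrite subr_gt0)).
  exists m => //.
  have [|m' hm'] := @eventual_cells_sup t h (eps - m.+1%:R^-1) s t0 h0 ts.
    by have := hm m (leqnn _); rewrite div1r; set u := _^-1; lra.
  by exists m'.
apply: measurableI => //; apply: bigcup_measurable => q _.
by apply: bigcup_measurable => m _; exact: measurable_eventual_cells.
Qed.

(** Fatou's lemma along grids: occupation time is lower semicontinuous under
    the approximation by visited cells, so it is bounded by grid counts. *)
Lemma visits_lt_count t h eps v : 0 <= t -> 0 < h ->
  (v%:E < mu (visits t h eps))%E ->
  exists m, forall M, (m <= M)%N ->
    v < h / M.+1%:R * (visit_count t h eps M.+1)%:R.
Proof.
move=> t0 h0 hv.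
pose G := eventual_cells t h eps.
have mG m : measurable (G m) by exact: measurable_eventual_cells.
have ndG : {homo G : n m / (n <= m)%N >-> (n <= m)%O}.
  move=> n m nm; apply/subsetPset => s Gs M /= mM; apply: Gs => /=; exact: leq_trans mM.
have mUG : measurable (\bigcup_m G m) by exact: bigcup_measurable.
have : (v%:E < mu (\bigcup_m G m))%E.
  apply: lt_le_trans hv _; apply: le_measure; rewrite ?inE//.
    exact: measurable_visits.
  move=> s [] /=; rewrite in_itv/= => ts xs.
  by have [m Gm] := eventual_cells_sup t0 h0 ts xs; exists m.
move=> hv'.
have : exists m, (v%:E < mu (G m))%E.
  apply: contrapT => /forallNP hn.
  have : (mu (\bigcup_m G m) <= v%:E)%E.
    have cvgG : (mu \o G) k @[k --> \oo] --> mu (\bigcup_m G m).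
      exact: nondecreasing_cvg_mu.
    rewrite -(cvg_lim _ cvgG)//; apply: lime_le.
      by apply/cvg_ex; exists (mu (\bigcup_m G m)).
    by apply: nearW => m /=; rewrite leNgt; apply/negP; exact: hn.
  by rewrite leNgt hv'.
move=> [m hm]; exists m => M mM; rewrite -lte_fin.
apply: lt_le_trans (visit_cells_le _ _ _ h0); apply: lt_le_trans hm _.
apply: le_measure; rewrite ?inE.
- exact: mG.
- exact: measurable_visit_cells.
- by move=> s Gs; exact: Gs.
Qed.

End OccupationOfPath.

Section LocalTimeOfPath.
Context {R : realType}.
Local Notation mu := (@lebesgue_measure R).
Variables (x : R -> R) (l : R -> R -> R).
Hypothesis rcx : right_continuous_path x.
Hypothesis occupation : forall (t : R) (A : set R), 0 <= t -> measurable A ->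
  mu (`[0, t] `&` [set s | A (x s)]) = (\int[mu]_(y in A) (l y t)%:E)%E.
Hypothesis continuous_l : forall t : R, 0 <= t -> continuous (l ^~ t).
Implicit Types (t h eps eta : R).

Definition near0 t eps : set R := `[0, t] `&` [set s | `|x s| < eps].

(** By continuity in space, the local time at [0] is the limit of the
    occupation time of [`]-eps, eps[] divided by [2 eps]. *)
Lemma occupation_near0 t eta : 0 <= t -> 0 < eta ->
  exists2 e, 0 < e & forall eps, 0 < eps < e ->
    ((2 * eps * (l 0 t - eta))%:E <= mu (near0 t eps))%E /\
    (mu (near0 t eps) <= (2 * eps * (l 0 t + eta))%:E)%E.
Proof.
move=> t0 eta0.
have /cvgrPdist_lt /(_ _ eta0) := @continuous_l t t0 0.
move=> /nbhs_ballP[e /= e0 he]; exists e => // eps /andP[eps0 epse].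
have lb y : `]- eps, eps[%classic y -> `|l 0 t - l y t| < eta.
  rewrite /= in_itv/= -ltr_norml => ye; apply: he.
  by rewrite /ball/= sub0r normrN (lt_trans ye).
pose B : set R := `]- eps, eps[%classic.
have e2 : mu B = (2 * eps)%:E.
  rewrite /B lebesgue_measure_itv/= lte_fin ifT; last by lra.
  by rewrite -EFinB; congr EFin; ring.
have muoo : (mu B < +oo)%E by rewrite e2 ltry.
rewrite /near0.
have -> : `[0, t] `&` [set s | `|x s| < eps] = `[0, t] `&` [set s | B (x s)].
  by congr (_ `&` _); apply/seteqP; split => s; rewrite /B /= in_itv/= ltr_norml.
have mi : measurable B by exact: measurable_itv.
rewrite occupation//.
have il : mu.-integrable B (EFin \o (l ^~ t)).
  apply: measurable_bounded_integrable => //.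
  - apply: measurable_funTS; apply: continuous_measurable_fun; exact: continuous_l.
  - exists (`|l 0 t| + eta); split; first exact: num_real.
    move=> M hM y /lb yl; have := ler_normD (l y t - l 0 t) (l 0 t).
    by rewrite subrK distrC /=; lra.
have ic c : mu.-integrable B (cst c%:E).
  apply: measurable_bounded_integrable => //; exists `|c|; split => //.
  by move=> M hM y _; exact: ltW.
have ec c : (\int[mu]_(y in B) c%:E = (2 * eps * c)%:E)%E.
  by rewrite integral_cst// [X in (_ * X)%E](_ : _ = (2 * eps)%:E)// -EFinM mulrC.
rewrite -2!ec; split; apply: le_integral => //; try exact: ic;
  move=> y /set_mem /lb; rewrite ltr_norml lee_fin; lra.
Qed.

Lemma measurable_occupation t eps : 0 <= t -> measurable (near0 t eps).
Proof.
move=> t0.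
have -> : near0 t eps =
   ([set 0] `&` [set s | `|x s| < eps]) `|` (`]0, 0 + t] `&` [set s | `|x s| < eps]).
  rewrite -setIUl /near0; congr (_ `&` _); rewrite add0r.
  by rewrite setU1itv ?bnd_simp.
apply: measurableU.
  have [h|h] := ltP `|x 0| eps.
    rewrite (_ : _ `&` _ = [set 0])//; apply/seteqP; split => [s []//|s /= ->].
    by split.
  rewrite (_ : _ `&` _ = set0)//; apply/seteqP; split => s //= [-> h'].
  by move: h; rewrite leNgt h'.
move: t0; rewrite le_eqVlt => /predU1P[<-|t0].
  by rewrite addr0 set_itvoc0 set0I.
exact: (measurable_visits rcx).
Qed.

Lemma occupationD t h eps : 0 <= t -> 0 < h ->
  mu (near0 (t + h) eps) =
    (mu (near0 t eps) + mu (visits x t h eps))%E.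
Proof.
move=> t0 h0; rewrite -measureU//.
- congr (mu _); rewrite /near0 /visits -setIUl; congr (_ `&` _).
  apply/seteqP; split => s /=; rewrite !in_itv/=.
    by case: (leP s t) => st /andP[-> h1]; [left|right]; rewrite //= h1.
  by move=> [/andP[h1 h2]|/andP[h1 h2]]; apply/andP; split=> //; lra.
- exact: measurable_occupation.
- exact: measurable_visits.
- apply/seteqP; split => s //; rewrite /near0 /visits /= !in_itv/=.
  by move=> -[[h1 _] [h2 _]]; lra.
Qed.

Lemma local_time_incr_visits t h y : 0 <= t -> 0 < h -> y < l 0 (t + h) - l 0 t ->
  exists2 e, 0 < e & forall eps, 0 < eps < e ->
    ((2 * eps * y)%:E < mu (visits x t h eps))%E.
Proof.
move=> t0 h0 hy; pose eta := (l 0 (t + h) - l 0 t - y) / 3.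
have eta0 : 0 < eta by rewrite divr_gt0// subr_gt0.
have [e1 e10 he1] := occupation_near0 t0 eta0.
have th0 : 0 <= t + h by rewrite addr_ge0// ltW.
have [e2 e20 he2] := occupation_near0 th0 eta0.
exists (Num.min e1 e2) => [|eps /andP[eps0]]; first by rewrite lt_min e10.
rewrite lt_min => /andP[ee1 ee2].
have [|_ h1] := he1 eps; first by rewrite eps0.
have [|h2 _] := he2 eps; first by rewrite eps0.
rewrite occupationD// in h2.
set A := mu _ in h1 h2 *; set B := mu _ in h2 *.
have fA : A \is a fin_num.
  by rewrite ge0_fin_numE ?measure_ge0// (le_lt_trans h1)// ltry.
rewrite ltNge; apply/negP => h3.
have fB : B \is a fin_num.
  by rewrite ge0_fin_numE ?measure_ge0// (le_lt_trans h3)// ltry.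
move: h1 h2 h3; rewrite -(fineK fA) -(fineK fB) -EFinD !lee_fin.
have -> : l 0 (t + h) = l 0 t + y + 3 * eta by rewrite /eta; field.
by move: (fine A) (fine B) => a b; nra.
Qed.

Lemma local_time_nondecreasing s t : 0 <= s -> s <= t -> l 0 s <= l 0 t.
Proof.
move=> s0; rewrite le_eqVlt => /predU1P[->//|st].
rewrite leNgt; apply/negP => lts.
pose eta := (l 0 s - l 0 t) / 3.
have eta0 : 0 < eta by rewrite divr_gt0// subr_gt0.
have t0 : 0 <= t by lra.
have [e1 e10 he1] := occupation_near0 s0 eta0.
have [e2 e20 he2] := occupation_near0 t0 eta0.
pose eps := Num.min e1 e2 / 2.
have m0 : 0 < Num.min e1 e2 by rewrite lt_min e10.
have eps0 : 0 < eps by rewrite divr_gt0.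
have epsm : eps < Num.min e1 e2 by rewrite /eps; lra.
move: epsm; rewrite lt_min => /andP[ee1 ee2].
have [|h1 _] := he1 eps; first by rewrite eps0.
have [|_ h2] := he2 eps; first by rewrite eps0.
have : ((2 * eps * (l 0 s - eta))%:E <= (2 * eps * (l 0 t + eta))%:E)%E.
  apply: le_trans h1 _; apply: le_trans _ h2.
  apply: le_measure; rewrite ?inE; try exact: measurable_occupation.
  by apply: setSI => u /=; rewrite !in_itv/= => /andP[-> us]; exact: le_trans (ltW st).
rewrite lee_fin ler_pM2l ?mulr_gt0//.
have -> : l 0 s = l 0 t + 3 * eta by rewrite /eta; field.
lra.
Qed.

Lemma local_time0 : l 0 0 = 0.
Proof.
have z eps : mu (near0 0 eps) = 0%E.
  apply/eqP; rewrite -measure_le0 -(lebesgue_measure_set1 0); apply: le_measure.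
  - by rewrite inE; exact: measurable_occupation.
  - by rewrite inE.
  - by rewrite /near0 set_itv1; exact: subIsetl.
apply/eqP; rewrite -normr_le0; apply/ler_addgt0Pr => eta eta0; rewrite add0r.
have [e e0 he] := occupation_near0 (lexx 0) eta0.
have [|h1 h2] := he (e / 2); first by apply/andP; split; lra.
move: h1 h2; rewrite z !lee_fin => h1 h2.
by rewrite ler_norml; apply/andP; split; nra.
Qed.

End LocalTimeOfPath.

(** * Almost sure statements and regularity of paths *)

Section AlmostSure.
Context {d : measure_display} {T : measurableType d} {R : realType}.
Variable P : probability T R.

Definition eventually_set (B : nat -> set T) : set T :=
  \bigcup_m \bigcap_(M in [set M | (m <= M)%N]) B M.

Lemma measurable_eventually_set B : (forall M, measurable (B M)) ->
  measurable (eventually_set B).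
Proof.
move=> mB; apply: bigcup_measurable => m _.
by apply: bigcap_measurableType => M _; exact: mB.
Qed.

(** Fatou's lemma for events, in the form used to pass a tail bound from grid
    counts to their limit. *)
Lemma prob_eventually_le (A : set T) (B : nat -> set T) (c : R) :
  measurable A -> (forall M, measurable (B M)) ->
  {ae P, forall w, A w -> eventually_set B w} ->
  (exists m0, forall M, (m0 <= M)%N -> prob P (B M) <= c) ->
  prob P A <= c.
Proof.
move=> mA mB AB [m0 hB].
pose C m := \bigcap_(M in [set M | (m <= M)%N]) B M.
have mC m : measurable (C m) by apply: bigcap_measurableType => M _; exact: mB.
have mUC : measurable (\bigcup_m C m) by exact: bigcup_measurable.
have ndC : {homo C : n m / (n <= m)%N >-> (n <= m)%O}.
  move=> n m nm; apply/subsetPset => s Gs M /= mM; apply: Gs => /=; exact: leq_trans mM.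
have UC : (P (\bigcup_m C m) <= c%:E)%E.
  have cvgC : (P \o C) k @[k --> \oo] --> P (\bigcup_m C m).
    exact: nondecreasing_cvg_mu.
  rewrite -(cvg_lim _ cvgC)//; apply: lime_le.
    by apply/cvg_ex; exists (P (\bigcup_m C m)).
  apply: nearW => m /=; rewrite probE// lee_fin.
  apply: le_trans (hB (maxn m m0) (leq_maxr _ _)); apply: le_prob => //.
  by move=> w; apply; exact: leq_maxl.
have : {ae P, forall w, ~ (A `&` ~` \bigcup_m C m) w}.
  by apply: filterS AB => w h [/h].
have mD : measurable (A `&` ~` \bigcup_m C m).
  by apply: measurableI => //; exact: measurableC.
move=> hD; have PD : P (A `&` ~` \bigcup_m C m) = 0%E.
  apply: measure_negligible => //; apply: negligibleS hD => w Dw /= h; exact: h.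
rewrite (prob_split P mA mUC) [X in _ + X](_ : _ = 0) ?addr0; last by rewrite /prob PD.
rewrite -lee_fin -probE; last exact: measurableI.
apply: le_trans UC; apply: le_measure; rewrite ?inE//; exact: measurableI.
Qed.

(** Level [n] has [K 2^n] dyadic intervals, each with a failure probability of
    order [4^(-n)]. *)
Lemma borel_cantelli_dyadic (A : nat -> nat -> set T) (K : nat) (c : R) :
  0 <= c -> (forall n k, measurable (A n k)) ->
  (forall n k, prob P (A n k) <= c * 4^-1 ^+ n) ->
  {ae P, forall w, exists n0, forall n k, (n0 <= n)%N ->
     (k < K * 2 ^ n)%N -> ~ A n k w}.
Proof.
move=> c0 mA hA.
pose F n := \big[setU/set0]_(k < K * 2 ^ n) A n k.
have mF n : measurable (F n) by apply: bigsetU_measurable.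
have hF n : (P (F n) <= (c * K%:R * 2^-1 ^+ n)%:E)%E.
  apply: (@le_trans _ _ (\sum_(k < K * 2 ^ n) P (A n k))%E).
    exact: (Boole_inequality P (fun k _ => mA n k)).
  apply: (@le_trans _ _ (\sum_(k < K * 2 ^ n) (c * 4^-1 ^+ n)%:E)%E).
    by apply: lee_sum => k _; rewrite probE// lee_fin.
  rewrite sumEFin lee_fin sumr_const card_ord -[leLHS]mulr_natr natrM natrX.
  have -> : 4^-1 = 2^-1 * 2^-1 :> R by rewrite -invfM -natrM.
  rewrite exprMn le_eqVlt; apply/orP; left; apply/eqP.
  have : 2^-1 ^+ n * 2 ^+ n = 1 :> R by rewrite -exprMn mulVf ?expr1n.
  move: (_ ^+ n) (_ ^+ n) => u v uv.
  have -> : c * (v * v) * (K%:R * u) = c * K%:R * v * (v * u) by ring.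
  by rewrite uv mulr1.
have sumF : (\sum_(n <oo) P (F n) < +oo)%E.
  apply: (@le_lt_trans _ _ (c * K%:R * 2)%:E); last by rewrite ltry.
  apply: lime_le; first by apply: is_cvg_nneseries => n _ _.
  apply: nearW => n.
  apply: (@le_trans _ _ (\sum_(0 <= i < n) (c * K%:R * 2^-1 ^+ i)%:E)%E).
    by apply: lee_sum => i _; exact: hF.
  rewrite sumEFin lee_fin -mulr_sumr ler_wpM2l ?mulr_ge0// big_mkord.
  have h2 : 0 <= (2^-1 : R) < 1 by apply/andP; split; lra.
  apply: le_trans (sum_geometric_le n h2) _.
  have -> : 1 - 2^-1 = 2^-1 :> R by lra.
  by rewrite invrK.
have := lim_sup_set_cvg0 mF sumF => h0.
exists (lim_sup_set F); split => //.
  by apply: bigcap_measurable => // n _; apply: bigcup_measurable => // k _.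
move=> w /= hw n _; apply: contrapT => hn; apply: hw.
exists n => m k nm kK Ak; apply: hn; exists m => //=.
by rewrite /F -bigcup_mkord; exists k.
Qed.

End AlmostSure.

Section PathRegularity.
Context {R : realType}.

Lemma right_continuousP (x : R -> R) (s : R) : x u @[u --> s^'+] --> x s ->
  forall eta : R, 0 < eta -> exists2 e : R, 0 < e &
    forall s' : R, s <= s' < s + e -> `|x s' - x s| < eta.
Proof.
move=> /cvgrPdist_lt hx eta eta0.
have /nbhs_ballP[e /= e0 he] := hx _ eta0.
exists e => // s' /andP[]; rewrite le_eqVlt => /predU1P[<-|ss'] s'e.
  by rewrite subrr normr0.
rewrite distrC; apply: he => //.
by rewrite /ball/= distrC gtr0_norm ?subr_gt0//; lra.
Qed.

Lemma continuous_section (l : R -> R -> R) (t : R) : 0 <= t ->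
  {within [set p : R * R | 0 <= p.2], continuous (fun p : R * R => l p.1 p.2)} ->
  continuous (l ^~ t).
Proof.
move=> t0 /subspace_continuousP hl y U /= /(hl (y, t) t0).
move=> /nbhs_ballP[e /= e0 he].
apply/nbhs_ballP; exists e => //= y' yy'.
by apply: (he (y', t)) => //; split => //=; exact: ballxx.
Qed.

End PathRegularity.

(** * Dyadic chaining *)

Section Chaining.
Context {R : realType}.
Variables (f : R -> R) (g : nat -> R) (r : R) (K n0 : nat).
Hypothesis contf : continuous f.
Hypotheses (r01 : 0 <= r < 1) (g0 : forall n, 0 <= g n).
Hypothesis ratio : forall n, (n0 <= n)%N -> g n.+1 <= r * g n.
Hypothesis step : forall n k, (n0 <= n)%N -> (k < K * 2 ^ n)%N ->
  `|f (k%:R / 2 ^+ n + (2 ^+ n)^-1) - f (k%:R / 2 ^+ n)| <= g n.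

Definition dyadic_floor (n : nat) (u : R) : nat := Num.truncn (u * 2 ^+ n).

Lemma dyadic_floor_itv n (u : R) : 0 <= u ->
  (dyadic_floor n u)%:R / 2 ^+ n <= u < (dyadic_floor n u)%:R / 2 ^+ n + (2 ^+ n)^-1.
Proof.
move=> u0; have e0 : 0 < 2 ^+ n :> R by rewrite exprn_gt0.
have /andP[h1 h2] := truncn_itv (mulr_ge0 u0 (ltW e0)).
rewrite ler_pdivrMr// h1/= -[X in _ + X]div1r -mulrDl natr1.
by rewrite ltr_pdivlMr.
Qed.

Lemma dyadic_floor_lt n (u : R) : 0 <= u < K%:R -> (dyadic_floor n u < K * 2 ^ n)%N.
Proof.
move=> /andP[u0 uK]; have e0 : 0 < 2 ^+ n :> R by rewrite exprn_gt0.
have /andP[h1 _] := dyadic_floor_itv n u0.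
have := le_lt_trans h1 uK; rewrite ltr_pdivrMr// -natrX -natrM ltr_nat.
by [].
Qed.

Lemma dyadic_floorS n (u : R) : 0 <= u ->
  dyadic_floor n.+1 u = (dyadic_floor n u).*2 \/
  dyadic_floor n.+1 u = (dyadic_floor n u).*2.+1.
Proof.
move=> u0.
have e0 k : 0 < 2 ^+ k :> R by rewrite exprn_gt0.
have /andP[a1 a2] := truncn_itv (mulr_ge0 u0 (ltW (e0 n))).
have /andP[b1 b2] := truncn_itv (mulr_ge0 u0 (ltW (e0 n.+1))).
rewrite -/(dyadic_floor n u) in a1 a2; rewrite -/(dyadic_floor n.+1 u) in b1 b2.
rewrite exprS mulrCA in b1 b2.
have h1 : (dyadic_floor n.+1 u < (dyadic_floor n u).+1.*2)%N.
  rewrite -(ltr_nat R) -muln2 natrM; apply: le_lt_trans b1 _.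
  by rewrite mulrC ltr_pM2r.
have h2 : ((dyadic_floor n u).*2 < (dyadic_floor n.+1 u).+1)%N.
  rewrite -(ltr_nat R) -muln2 natrM; apply: le_lt_trans _ b2.
  by rewrite mulrC ler_pM2l.
lia.
Qed.

Lemma chain_step n (u : R) : (n0 <= n)%N -> 0 <= u < K%:R ->
  `|f ((dyadic_floor n.+1 u)%:R / 2 ^+ n.+1) -
    f ((dyadic_floor n u)%:R / 2 ^+ n)| <= g n.+1.
Proof.
move=> nn uK; have /andP[u0 _] := uK.
have e0 k : 0 < 2 ^+ k :> R by rewrite exprn_gt0.
have eq2 : (dyadic_floor n u)%:R / 2 ^+ n = (dyadic_floor n u).*2%:R / 2 ^+ n.+1 :> R.
  by rewrite -mul2n natrM exprS; field; rewrite gt_eqF.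
case: (dyadic_floorS n u0) => h.
  by rewrite h eq2 subrr normr0.
rewrite h eq2 -natr1 mulrDl mul1r; apply: step; first by lia.
by have := dyadic_floor_lt n.+1 uK; rewrite h; lia.
Qed.

(** The sum of the steps telescopes: [(1 - r) g n.+1 <= r (g n - g n.+1)]. *)
Lemma chain_partial n i (u : R) : (n0 <= n)%N -> 0 <= u < K%:R ->
  (1 - r) * `|f ((dyadic_floor (n + i) u)%:R / 2 ^+ (n + i)) -
     f ((dyadic_floor n u)%:R / 2 ^+ n)| <= r * (g n - g (n + i)).
Proof.
move=> nn uK; have /andP[r0 r1] := r01.
elim: i => [|i IH]; first by rewrite addn0 !subrr normr0 !mulr0.
have ni : (n0 <= n + i)%N by lia.
have := chain_step ni uK; have := ratio ni; rewrite addnS.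
set a := f _; set b := f (_ / 2 ^+ (n + i)) in IH *; set c := f _ in IH *.
move=> h1 h2; have h3 : `|a - c| <= `|a - b| + `|b - c|.
  by rewrite (le_trans _ (ler_normD _ _))// subrKA.
have h4 : (1 - r) * `|a - b| <= (1 - r) * g (n + i).+1.
  by rewrite ler_wpM2l// subr_ge0 ltW.
have h5 : (1 - r) * `|a - c| <= (1 - r) * (`|a - b| + `|b - c|).
  by rewrite ler_wpM2l// subr_ge0 ltW.
rewrite !mulrDr in h5; lra.
Qed.

Lemma dyadic_floor_cvg (u e : R) : 0 <= u -> 0 < e ->
  exists i0, forall i, (i0 <= i)%N -> `|u - (dyadic_floor i u)%:R / 2 ^+ i| < e.
Proof.
move=> u0 e0; have [m hm] := inv_small ltr01 e0.
exists m => i mi; have /andP[h1 h2] := dyadic_floor_itv i u0.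
rewrite ger0_norm ?subr_ge0//.
have := hm _ mi; rewrite div1r => h3.
have : (2 ^+ i)^-1 <= i.+1%:R^-1 :> R.
  by rewrite lef_pV2 ?posrE ?exprn_gt0// -natrX ler_nat ltn_expl.
move=> h4; rewrite ltrBlDr addrC (lt_le_trans h2)// lerD2l.
exact: le_trans h4 (ltW h3).
Qed.

Lemma chain_limit n (u : R) : (n0 <= n)%N -> 0 <= u < K%:R ->
  (1 - r) * `|f u - f ((dyadic_floor n u)%:R / 2 ^+ n)| <= g n.
Proof.
move=> nn uK; have /andP[r0 r1] := r01; have /andP[u0 _] := uK.
apply/ler_addgt0Pr => eta eta0.
have /cvgrPdist_lt /(_ _ eta0) /nbhs_ballP[e /= e0 he] := @contf u.
have [i hi] := dyadic_floor_cvg u0 e0.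
have h1 := he _ (hi (n + i)%N (leq_addl _ _)); rewrite /= in h1.
have h2 := chain_partial i nn uK.
move: h1 h2; set a := f _; set b := f (_ / 2 ^+ (n + i)); set c := f _ => h1 h2.
have h3 : `|a - c| <= `|a - b| + `|b - c|.
  by rewrite (le_trans _ (ler_normD _ _))// subrKA.
have h4 : (1 - r) * `|a - b| <= eta.
  by have := normr_ge0 (a - b); nra.
have h5 : (1 - r) * `|a - c| <= (1 - r) * (`|a - b| + `|b - c|).
  by rewrite ler_wpM2l// subr_ge0 ltW.
have h6 : r * (g n - g (n + i)) <= g n.
  by have := g0 n; have := g0 (n + i); nra.
rewrite mulrDr in h5; lra.
Qed.

(** Levy's chaining: two points at distance at most [2^(-n)] have neighbouring
    approximations at level [n], and the oscillations over the finer levels form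
    a geometric series. *)
Lemma chaining n (u v : R) : (n0 <= n)%N -> 0 <= u < K%:R -> 0 <= v < K%:R ->
  `|u - v| <= (2 ^+ n)^-1 -> `|f u - f v| <= 3 / (1 - r) * g n.
Proof.
move=> nn; have /andP[r0 r1] := r01.
have e0 : 0 < 2 ^+ n :> R by rewrite exprn_gt0.
have r1' : 0 < 1 - r by lra.
wlog uv : u v / u <= v => [hw uK vK huv|].
  have [/hw|/ltW /hw] := leP u v; first exact.
  by move=> h; rewrite distrC; apply: h => //; rewrite distrC.
move=> uK vK; rewrite distrC ger0_norm ?subr_ge0// => huv.
have /andP[u0 _] := uK; have /andP[v0 _] := vK.
have /andP[a1 a2] := dyadic_floor_itv n u0.
have /andP[b1 b2] := dyadic_floor_itv n v0.
have hu := chain_limit nn uK; have hv := chain_limit nn vK.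
set p := dyadic_floor n u in a1 a2 hu *; set q := dyadic_floor n v in b1 b2 hv *.
have pq : (p < q.+1)%N.
  rewrite -(ltr_nat R) -natr1 -(ltr_pM2r (x := (2 ^+ n)^-1)) ?invr_gt0//.
  by rewrite mulrDl mul1r; lra.
have qp : (q < p.+2)%N.
  rewrite -(ltr_nat R) -natr1 -natr1 -(ltr_pM2r (x := (2 ^+ n)^-1)) ?invr_gt0//.
  by rewrite !mulrDl mul1r; lra.
have hpq : `|f (p%:R / 2 ^+ n) - f (q%:R / 2 ^+ n)| <= g n.
  have [->|->] : q = p \/ q = p.+1.
    by move: (p) (q) pq qp => p' q'; clear; lia.
  - by rewrite subrr normr0.
  rewrite -[p.+1%:R]natr1 mulrDl mul1r distrC; apply: step => //.
  exact: dyadic_floor_lt.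
move: hu hv hpq; set a := f _; set b := f _; set c := f _; set e := f _ => hu hv hpq.
rewrite mulrAC ler_pdivlMr// mulrC.
have h : `|a - c| <= `|a - b| + `|b - e| + `|c - e|.
  rewrite (distrC c e).
  have -> : a - c = (a - b) + (b - e) + (e - c) by ring.
  by rewrite (le_trans (ler_normD _ _))// lerD2r ler_normD.
have : (1 - r) * `|b - e| <= g n by have := normr_ge0 (b - e); nra.
have : (1 - r) * `|a - c| <= (1 - r) * (`|a - b| + `|b - e| + `|c - e|).
  by rewrite ler_wpM2l// ltW.
rewrite !mulrDr; lra.
Qed.

End Chaining.

(** * Modulus of continuity of the local time *)

Section LocalTimeModulus.
Context {d : measure_display} {T : measurableType d} {R : realType}.
Variable P : probability T R.
Variables (X : R -> {RV P >-> R}) (L : R -> R -> {RV P >-> R}).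
Hypothesis levyX : levy_process X.
Hypothesis localL : local_time X L.
Variables (gamma C0 : R).
Hypotheses (gamma01 : 0 < gamma < 1) (C00 : 0 < C0).
Hypothesis smallX : forall r eps : R, 0 < r -> 0 < eps ->
  prob P [set w | `|X r w| < eps] <= C0 * (eps * r `^ (- gamma)).
Implicit Types (t h lam y : R).

Definition good_path (w : T) : Prop :=
  [/\ X 0 w = 0,
   right_continuous_path (X ^~ w),
   forall (t : R) (A : set R), 0 <= t -> measurable A ->
     lebesgue_measure (`[0, t] `&` [set s | A (X s w)]) =
     (\int[lebesgue_measure]_(z in A) (L z t w)%:E)%E &
   forall t : R, 0 <= t -> continuous (fun z => L z t w)].

Lemma ae_good_path : {ae P, forall w, good_path w}.
Proof.
have h1 := levy_start levyX.
have h2 := levy_cadlag levyX.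
have h3 := local_time_density localL.
have h4 := local_time_continuous localL.
near=> w; split.
- by near: w.
- move=> s s0; apply: (right_continuousP (x := X ^~ w)).
  have [+ _] : cadlag (fun t => X t w) by near: w.
  by move=> /(_ s s0).
- by near: w.
- move=> t t0; apply: (continuous_section (l := fun z t => L z t w)) => //.
  by near: w.
Unshelve. all: by end_near.
Qed.

(** The free parameter [lam] is the discount rate of the renewal argument;
    optimising it gives the tail [e^(- c x^alpha)] of the local time at scale
    [h^(1 - 1/alpha)]. *)
Lemma local_time_tail t h lam y : 0 <= t -> 0 < h -> 0 < lam -> 0 <= y ->
  prob P [set w | y < L 0 (t + h) w - L 0 t w] <=
    2 * expR (lam * h - lam `^ (1 - gamma) * y / visit_const gamma C0).
Proof.
move=> t0 h0 lam0 y0.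
have /andP[g0 g1] := gamma01.
have GC0 := visit_const_gt0 gamma01 C00.
set c := 2 * expR _.
pose eps (k : nat) : R := k.+1%:R^-1.
have eps0 k : 0 < eps k by rewrite invr_gt0.
pose dt (M : nat) := h / M.+1%:R.
have dt0 M : 0 < dt M by rewrite divr_gt0.
pose B k M := [set w | 2 * eps k * y / dt M <
   (hits (grid_visit X t (dt M) (eps k)) M.+1 w)%:R].
have mB k M : measurable (B k M).
  rewrite /B lt_hitsE; last first.
    by rewrite !mulr_ge0 ?invr_ge0// ?(ltW (dt0 M)) ?(ltW (eps0 k)).
  apply: measurable_hits_ge => i; apply: measurable_abs_lt; exact: measurable_incr.
have mL : measurable [set w | y < L 0 (t + h) w - L 0 t w].
  by apply: measurable_gt; apply: measurable_funB; exact: measurable_funP.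
have hitE w k M : X 0 w = 0 ->
    hits (grid_visit X t (dt M) (eps k)) M.+1 w = visit_count (X ^~ w) t h (eps k) M.+1.
  move=> X0; rewrite /hits /visit_count; apply: eq_bigr => i _.
  rewrite /grid_visit; congr nat_of_bool.
  by apply/idP/idP => [/set_mem|hh]; [|apply/mem_set]; rewrite /= X0 subr0.
apply: (@prob_eventually_le _ _ _ P _ (fun k => eventually_set (B k)) c mL).
- by move=> k; exact: measurable_eventually_set.
- apply: filterS ae_good_path => w [X0 rcX occ contL] /= hw.
  have [e e0 he] := local_time_incr_visits rcX occ contL t0 h0 hw.
  have [m hm] := inv_small ltr01 e0.
  exists m => // k /= mk.
  have [|m' hm'] := visits_lt_count rcX t0 h0 (he (eps k) _).
    by rewrite eps0/= /eps -div1r hm.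
  exists m' => // M /= mM; rewrite /B /= hitE//.
  by rewrite ltr_pdivrMr// [ltRHS]mulrC; exact: hm'.
- exists 0%N => k _.
  apply: (@prob_eventually_le _ _ _ P _ (B k) c).
  + exact: measurable_eventually_set.
  + by [].
  + exact: aeW.
  + have q0 : 0 < h * lam `^ (1 - gamma) / (visit_const gamma C0 * eps k).
      by apply: divr_gt0; apply: mulr_gt0 => //; exact: powR_gt0.
    have [m hm] := inv_small q0 ltr01.
    exists m => M mM.
    have -> : c = 2 * expR (lam * dt M * M.+1%:R -
        lam `^ (1 - gamma) * y / visit_const gamma C0).
      by rewrite -mulrA /dt divfK.
    apply: hits_tail => //.
    apply: le_trans (ltW (hm M mM)); rewrite /dt le_eqVlt; apply/orP; left; apply/eqP.
    ring.
Qed.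

(** [h^(1 - 1/alpha) (log 1/h)^(1/alpha)] at [h = 2^(-n)], up to a constant;
    the shift to [n.+1] keeps the logarithm positive at level [0]. *)
Definition local_time_modulus (n : nat) : R :=
  3 * visit_const gamma C0 * (2 ^+ n) `^ (- (1 - gamma)) * n.+1%:R `^ gamma.

Lemma local_time_modulus_ge0 n : 0 <= local_time_modulus n.
Proof.
have /andP[g0 g1] := gamma01.
have GC0 := ltW (visit_const_gt0 gamma01 C00).
by apply: mulr_ge0; [apply: mulr_ge0; [apply: mulr_ge0|]|]; rewrite ?powR_ge0.
Qed.

Lemma local_time_dyadic (b : nat) :
  {ae P, forall w, exists n0, forall n k, (n0 <= n)%N -> (k < b * 2 ^ n)%N ->
    L 0 (k%:R / 2 ^+ n + (2 ^+ n)^-1) w - L 0 (k%:R / 2 ^+ n) w <= local_time_modulus n}.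
Proof.
have /andP[g0 g1] := gamma01.
have GC0 := visit_const_gt0 gamma01 C00.
pose A n k := [set w | local_time_modulus n <
  L 0 (k%:R / 2 ^+ n + (2 ^+ n)^-1) w - L 0 (k%:R / 2 ^+ n) w].
have mA n k : measurable (A n k).
  by apply: measurable_gt; apply: measurable_funB; exact: measurable_funP.
have : {ae P, forall w, exists n0, forall n k, (n0 <= n)%N ->
    (k < b * 2 ^ n)%N -> ~ A n k w}.
  apply: (@borel_cantelli_dyadic _ _ _ P A b 2) => // n k.
  have e0 : 0 < 2 ^+ n :> R by rewrite exprn_gt0.
  have n0 : 0 < n.+1%:R :> R by [].
  (* [lam h = n.+1], while [lam `^ (1 - gamma)] times the modulus, divided by
     the constant, is three times as large *)
  apply: le_trans (@local_time_tail (k%:R / 2 ^+ n) (2 ^+ n)^-1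
    (n.+1%:R * 2 ^+ n) (local_time_modulus n) _ _ _ _) _.
  - by rewrite divr_ge0// ltW.
  - by rewrite invr_gt0.
  - by rewrite mulr_gt0.
  - exact: local_time_modulus_ge0.
  rewrite ler_pM2l//.
  have -> : n.+1%:R * 2 ^+ n * (2 ^+ n)^-1 -
      (n.+1%:R * 2 ^+ n) `^ (1 - gamma) * local_time_modulus n / visit_const gamma C0
     = - (2 * n.+1%:R).
    rewrite mulfK ?gt_eqF// (powRM _ (ltW n0) (ltW e0)) /local_time_modulus.
    have u : (2 ^+ n) `^ (1 - gamma) * (2 ^+ n) `^ (- (1 - gamma)) = 1 :> R.
      by rewrite -powRD ?subrr ?powRr0// (gt_eqF e0) implybT.
    have v : n.+1%:R `^ (1 - gamma) * n.+1%:R `^ gamma = n.+1%:R :> R.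
      by rewrite -powRD ?subrK ?powRr1 ?ltW// (gt_eqF n0) implybT.
    have alg (a b' a1 b1 m g : R) : g != 0 -> a * a1 = m -> b' * b1 = 1 ->
       m - (a * b') * (3 * g * b1 * a1) / g = - (2 * m).
      move=> gn0 <- bb.
      have -> : a * b' * (3 * g * b1 * a1) / g = 3 * (a * a1) * (b' * b1) by field.
      by rewrite bb; ring.
    by apply: alg => //; rewrite gt_eqF.
  exact: expR_neg2_le.
apply: filterS => w [n0 hn]; exists n0 => n k nn kb.
by rewrite leNgt; apply/negP; exact: hn.
Qed.

End LocalTimeModulus.

Section LocalTimeUniform.
Context {d : measure_display} {T : measurableType d} {R : realType}.
Variable P : probability T R.
Variables (X : R -> {RV P >-> R}) (L : R -> R -> {RV P >-> R}).
Hypothesis levyX : levy_process X.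
Hypothesis localL : local_time X L.
Variables (gamma C0 : R).
Hypotheses (gamma01 : 0 < gamma < 1) (C00 : 0 < C0).
Hypothesis smallX : forall r eps : R, 0 < r -> 0 < eps ->
  prob P [set w | `|X r w| < eps] <= C0 * (eps * r `^ (- gamma)).

(** Since [t |-> L 0 t w] is nondecreasing, an increment over a length [2^(-n)] is
    at most the sum of those over two consecutive dyadic intervals. *)
Lemma local_time_uniform_modulus (b : R) :
  {ae P, forall w,
    [/\ L 0 0 w = 0, forall s t : R, 0 <= s -> s <= t -> L 0 s w <= L 0 t w &
     exists n0, forall n, (n0 <= n)%N -> forall s t : R, 0 <= s -> s <= t -> t <= b ->
       t - s <= (2 ^+ n)^-1 -> L 0 t w - L 0 s w <= 2 * local_time_modulus gamma C0 n]}.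
Proof.
pose K := (Num.truncn (`|b| + 1)).+1.
have KE : `|b| + 1 < K%:R.
  by have /andP[] := @truncn_itv R (`|b| + 1) (addr_ge0 (normr_ge0 _) ler01).
have hd := local_time_dyadic levyX localL gamma01 C00 smallX K.
apply: filterS2 (ae_good_path levyX localL) hd => w [X0 rcX occ contL] [n0 hn].
split.
- exact: (local_time0 (x := X ^~ w) (l := fun z t => L z t w)).
- exact: (local_time_nondecreasing (x := X ^~ w) (l := fun z t => L z t w)).
exists n0 => n nn s t s0 st tb ts.
have mono := local_time_nondecreasing (x := X ^~ w) (l := fun z t => L z t w)
  rcX occ contL.
have /andP[k1 k2] := dyadic_floor_itv n s0.
set k := dyadic_floor n s in k1 k2 *.
have e0 : 0 < 2 ^+ n :> R by rewrite exprn_gt0.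
have i0 : 0 < (2 ^+ n)^-1 :> R by rewrite invr_gt0.
have i1 : (2 ^+ n)^-1 <= 1 :> R by rewrite invf_le1// exprn_ege1// ler1n.
have bb := ler_norm b.
have kS : k.+1%:R / 2 ^+ n = k%:R / 2 ^+ n + (2 ^+ n)^-1 :> R.
  by rewrite -[k.+1%:R]natr1 mulrDl mul1r.
have kK : (k.+1 < K * 2 ^ n)%N.
  rewrite -(ltr_nat R) natrM natrX -ltr_pdivrMr// kS; lra.
have h1 := hn n k nn (ltnW kK); have h2 := hn n k.+1 nn kK.
have k0 : 0 <= k%:R / 2 ^+ n :> R by rewrite divr_ge0// ltW.
have a1 := mono _ _ k0 k1.
have t2 : t <= k.+1%:R / 2 ^+ n + (2 ^+ n)^-1 by rewrite kS; lra.
have a2 := mono _ _ (le_trans s0 st) t2.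
rewrite -kS in h1; lra.
Qed.

Lemma local_time_modulus_small (e : R) : 0 < e ->
  exists N, forall n, (N <= n)%N -> local_time_modulus gamma C0 n <= e.
Proof.
move=> e0; have /andP[g0 g1] := gamma01.
have b0 : 0 < 1 - gamma by rewrite subr_gt0.
have l2 : 0 < ln 2 :> R by rewrite ln_gt0// ltr1n.
set G := 3 * visit_const gamma C0.
have G0 : 0 < G by rewrite mulr_gt0// visit_const_gt0.
pose q := (1 - gamma) * ln 2.
have q0 : 0 < q by rewrite mulr_gt0.
have Gq0 : 0 < G * 8 / q ^+ 2.
  by apply: divr_gt0; [exact: mulr_gt0|exact: exprn_gt0].
have [N hN] := inv_small Gq0 e0.
exists N.+1 => -[//|n] nN.
have n1 : 1 <= n.+1%:R :> R by rewrite ler1n.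
have n0 : 0 < n.+1%:R :> R by [].
apply: le_trans (ltW (hN n _)); last by rewrite -ltnS.
rewrite /local_time_modulus -/G.
have p1 : n.+2%:R `^ gamma <= 2 * n.+1%:R :> R.
  apply: (@le_trans _ _ n.+2%:R); first by rewrite ler1_powR ?ler1n// ltW.
  by rewrite -natr1; lra.
have p2 : (2 ^+ n.+1) `^ (- (1 - gamma)) <= 4 / (q * n.+1%:R) ^+ 2 :> R.
  have -> : (2 ^+ n.+1) `^ (- (1 - gamma)) = (expR (q * n.+1%:R / 2) ^+ 2)^-1 :> R.
    rewrite powRN /powR gt_eqF ?exprn_gt0// -expRM_natl; congr (_^-1); congr expR.
    by rewrite lnXn// -(mulr_natl (ln 2)) /q; field.
  have h := expR_ge1Dx (q * n.+1%:R / 2).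
  have qn : 0 < q * n.+1%:R by exact: mulr_gt0.
  rewrite ler_pdivlMr ?exprn_gt0// mulrC ler_pdivrMr ?exprn_gt0 ?expR_gt0//.
  by move: h; move: (expR _) => E h; nra.
have -> : G * 8 / q ^+ 2 / n.+1%:R = G * (4 / (q * n.+1%:R) ^+ 2) * (2 * n.+1%:R).
  by field; rewrite !gt_eqF.
apply: ler_pM; rewrite ?powR_ge0//.
  by rewrite mulr_ge0 ?powR_ge0// ltW.
by rewrite ler_wpM2l// ltW.
Qed.

Lemma local_time_modulus_ge_inv n : 4^-1 <= C0 ->
  (2 ^+ n)^-1 <= 2 * local_time_modulus gamma C0 n.
Proof.
move=> C1; have /andP[g0 g1] := gamma01.
have e1 : 1 <= 2 ^+ n :> R by rewrite exprn_ege1// ler1n.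
have e0 : 0 < 2 ^+ n :> R by rewrite exprn_gt0.
rewrite /local_time_modulus.
have a1 : 1 <= visit_const gamma C0.
  have i0 : 0 < (1 - gamma)^-1 by rewrite invr_gt0 subr_gt0.
  rewrite /visit_const; nra.
have a2 : (2 ^+ n)^-1 <= (2 ^+ n) `^ (- (1 - gamma)) :> R.
  by rewrite -powR_inv1 ?(ltW e0)// ler_powR//; lra.
have a3 : 1 <= n.+1%:R `^ gamma :> R.
  by rewrite -[leLHS](powRr0 (n.+1%:R : R)) ler_powR ?ler1n// ltW.
have i0 : 0 < (2 ^+ n)^-1 :> R by rewrite invr_gt0.
have b1 : 1 <= 2 * (3 * visit_const gamma C0) by lra.
apply: le_trans a2 _.
set y := (2 ^+ n) `^ _; set z := _ `^ gamma in a3 *.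
have y0 : 0 <= y by exact: powR_ge0.
have -> : 2 * (3 * visit_const gamma C0 * y * z) =
    2 * (3 * visit_const gamma C0) * z * y by ring.
by rewrite ler_peMl//; nra.
Qed.

End LocalTimeUniform.

(** * Gaussian tails *)

Section NormalLaw.
Context {R : realType}.
Implicit Types (m s z c : R).
Local Notation mu := (@lebesgue_measure R).

Lemma normal_peak_le s : 0 < s -> normal_peak s <= (2 * s)^-1.
Proof.
move=> s0; rewrite /normal_peak lef_pV2 ?posrE ?mulr_gt0//; last first.
  by rewrite sqrtr_gt0 mulrn_wgt0// mulr_gt0 ?exprn_gt0 ?pi_gt0.
have -> : 2 * s = Num.sqrt ((2 * s) ^+ 2) by rewrite sqrtr_sqr gtr0_norm ?mulr_gt0.
apply: ler_wsqrtr.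
have := @pi_ge2 R; have := exprn_gt0 2 s0; rewrite -mulr_natr exprMn; nra.
Qed.

Lemma normal_prob_itv_le m s c : 0 < s -> 0 <= c ->
  (normal_prob m s `[(- c)%R, c]%classic <= (c / s)%:E)%E.
Proof.
move=> s0 c0; pose B : set R := `[- c, c]%classic.
have mB : measurable B by exact: measurable_itv.
have muB : mu B = (2 * c)%:E.
  rewrite /B lebesgue_measure_itv/= lte_fin.
  by case: ifPn => h; rewrite -?EFinB; congr EFin; lra.
apply: (@le_trans _ _ (\int[mu]_(x in B) (normal_peak s)%:E)%E).
  apply: ge0_le_integral => //.
  - by move=> x _; rewrite lee_fin normal_pdf_ge0.
  - by apply/measurable_funTS/measurable_EFinP; exact: measurable_normal_pdf.
  - by move=> x _; rewrite lee_fin normal_pdf_ub// gt_eqF.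
rewrite integral_cst// [X in (_ * X)%E](_ : _ = (2 * c)%:E)// -EFinM lee_fin.
apply: (@le_trans _ _ ((2 * s)^-1 * (2 * c))).
  by rewrite ler_wpM2r ?normal_peak_le// mulr_ge0.
by rewrite le_eqVlt; apply/orP; left; apply/eqP; field; rewrite gt_eqF.
Qed.

(** Away from its mean the density is exponentially smaller than the normal
    density with twice the deviation, whose total mass is [1]. *)
Lemma normal_prob_tail m s z : 0 < s -> 0 <= z ->
  (normal_prob m s [set x | (z < `|x - m|)%R] <=
    (2 * expR (- (3 * z ^+ 2 / (8 * s ^+ 2))))%:E)%E.
Proof.
move=> s0 z0; set B := [set x | _]; set c := 2 * _.
have mB : measurable B.
  have mf : measurable_fun setT (fun x : R => `|x - m|).
    by apply: measurableT_comp => //; exact: measurable_funB.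
  have -> : B = (fun x : R => `|x - m|) @^-1` `]z, +oo[.
    by apply/seteqP; split => x; rewrite /= in_itv/= andbT.
  by rewrite -[X in measurable X]setTI; exact: mf.
have c0 : 0 <= c by rewrite /c mulr_ge0 ?expR_ge0.
have s20 : 0 < 2 * s by rewrite mulr_gt0.
apply: (@le_trans _ _ (\int[mu]_(x in B) (c * normal_pdf m (2 * s) x)%:E)%E).
  apply: ge0_le_integral => //.
  - by move=> x _; rewrite lee_fin normal_pdf_ge0.
  - by apply/measurable_funTS/measurable_EFinP; exact: measurable_normal_pdf.
  - apply/measurable_funTS/measurable_EFinP; apply: measurable_funM => //.
    exact: measurable_normal_pdf.
  - move=> x; rewrite /B /= => zx; rewrite lee_fin !normal_pdfE ?gt_eqF//.
    rewrite /normal_fun.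
    have -> : normal_peak (2 * s) = normal_peak s / 2.
      have e : (2 * s) ^+ 2 * pi *+ 2 = 2 ^+ 2 * (s ^+ 2 * pi *+ 2) :> R.
        by rewrite exprMn mulrnAr mulrA.
      by rewrite /normal_peak e sqrtrM ?sqr_ge0// sqrtr_sqr ger0_norm// invfM mulrC.
    have -> : c * (normal_peak s / 2 * expR (- (x - m) ^+ 2 / ((2 * s) ^+ 2 *+ 2))) =
      normal_peak s * (expR (- (3 * z ^+ 2 / (8 * s ^+ 2))) *
        expR (- (x - m) ^+ 2 / ((2 * s) ^+ 2 *+ 2))).
      by rewrite /c; field.
    rewrite ler_wpM2l ?normal_peak_ge0// -expRD ler_expR.
    have zx2 : z ^+ 2 <= (x - m) ^+ 2.
      by rewrite -[leRHS]real_normK ?num_real// lerXn2r ?nnegrE// ltW.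
    have s2 : 0 < s ^+ 2 by rewrite exprn_gt0.
    rewrite -(mulr_natr (s ^+ 2)) -(mulr_natr ((2 * s) ^+ 2)) exprMn.
    have -> : - (x - m) ^+ 2 / (s ^+ 2 * 2) = - (4 * (x - m) ^+ 2) / (8 * s ^+ 2).
      by field; rewrite gt_eqF.
    have -> : - (3 * z ^+ 2 / (8 * s ^+ 2)) + - (x - m) ^+ 2 / (2 ^+ 2 * s ^+ 2 * 2) =
       - (3 * z ^+ 2 + (x - m) ^+ 2) / (8 * s ^+ 2).
      by field; rewrite gt_eqF.
    rewrite ler_pM2r ?invr_gt0 ?mulr_gt0//; lra.
under eq_integral do rewrite EFinM.
rewrite ge0_integralZl//; last 2 first.
- by apply/measurable_funTS/measurable_EFinP; exact: measurable_normal_pdf.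
- by move=> x _; rewrite lee_fin normal_pdf_ge0.
rewrite -[leRHS]mule1; apply: lee_wpmul2l; first by rewrite lee_fin.
rewrite -(integral_normal_pdf m (2 * s)).
apply: ge0_subset_integral => //.
- by apply/measurable_EFinP; exact: measurable_normal_pdf.
- by move=> x _; rewrite lee_fin normal_pdf_ge0.
Qed.

End NormalLaw.

Section GaussianTail.
Context {d : measure_display} {T : measurableType d} {R : realType}.
Variable P : probability T R.

Lemma chebyshev2 (f : T -> R) (sig : R) : measurable_fun setT f -> 0 < sig ->
  (\int[P]_w (f w ^+ 2)%:E <= (sig ^+ 2)%:E)%E ->
  3 / 4 <= prob P [set w | `|f w| <= 2 * sig].
Proof.
move=> mf sig0 hf.
set A := [set w | _ <= _].
have mN : measurable_fun setT (fun w => `|f w|) by exact: measurableT_comp.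
have mAC : measurable [set w | 2 * sig < `|f w|] by exact: measurable_gt.
have mA : measurable A.
  have -> : A = ~` [set w | 2 * sig < `|f w|].
    by apply/seteqP; split => w; rewrite /A /= leNgt => /negP.
  exact: measurableC.
have hs : 0 < sig ^+ 2 by rewrite exprn_gt0.
have := prob_split P measurableT mA; rewrite !setTI probT.
suff : prob P (~` A) <= 4^-1 by lra.
have -> : ~` A = [set w | 2 * sig < `|f w|].
  by apply/seteqP; split => w; rewrite /A /= ltNge => /negP.
have : ((4 * sig ^+ 2) * prob P [set w | 2 * sig < `|f w|] <= sig ^+ 2).
  rewrite -lee_fin; apply: le_trans hf.
  rewrite EFinM -probE//.
  have <- : (\int[P]_w (\1_[set w | 2 * sig < `|f w|] w)%:E =
      P [set w | (2 * sig < `|f w|)%R])%E.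
    by rewrite integral_indic// setIT.
  rewrite -ge0_integralZl//; last 2 first.
  - by apply/measurable_EFinP; exact: measurable_indic.
  - by rewrite lee_fin mulr_ge0// ltW.
  apply: ge0_le_integral => //.
  - by move=> w _; rewrite -EFinM lee_fin mulr_ge0// mulr_ge0// ltW.
  - by apply/measurable_EFinP; apply: measurable_funM => //; exact: measurable_indic.
  - by apply/measurable_EFinP; exact: measurable_funX.
  - move=> w _; rewrite -EFinM lee_fin indicE.
    have [/set_mem/= hw|_] := boolP (w \in _); last by rewrite mulr0 sqr_ge0.
    rewrite mulr1 -[leRHS]real_normK ?num_real//.
    by have := ltW hw; have := sig0; nra.
nra.
Qed.

(** By Chebyshev's inequality the interval of length [4 sig] around [0] carries
    mass at least [3/4], which bounds the parameters of the law by multiples of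
    [sig]: a flat density puts less mass on it, and so does a distant mean.  The
    threshold on [y] makes the mean at most half of [y sig]. *)
Lemma gaussian_tail (f : T -> R) (sig y : R) : measurable_fun setT f ->
  normally_distributed P f -> 0 < sig -> 22 <= y ->
  (\int[P]_w (f w ^+ 2)%:E <= (sig ^+ 2)%:E)%E ->
  prob P [set w | y * sig < `|f w|] <= 2 * expR (- (y ^+ 2 / 96)).
Proof.
move=> mf [m [s [s0 law]]] sig0 y22 hf.
have cheb := chebyshev2 mf sig0 hf.
have mtail (z m' : R) : measurable [set x : R | z < `|x - m'|].
  have mg : measurable_fun setT (fun x : R => `|x - m'|).
    by apply: measurableT_comp => //; exact: measurable_funB.
  have -> : [set x | z < `|x - m'|] = (fun x : R => `|x - m'|) @^-1` `]z, +oo[.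
    by apply/seteqP; split => x; rewrite /= in_itv/= andbT.
  by rewrite -[X in measurable X]setTI; exact: mg.
have preI : [set w | `|f w| <= 2 * sig] = f @^-1` `[- (2 * sig), 2 * sig].
  by apply/seteqP; split => w; rewrite /= in_itv/= ler_norml.
have mpre (A : set R) : measurable A -> measurable (f @^-1` A).
  by move=> mA; rewrite -[X in measurable X]setTI; exact: mf.
have e0 := expR_gt0 (- (y ^+ 2 / 96)).
have [sz|snz] := eqVneq s 0.
  have lawm A : measurable A -> P (f @^-1` A) = \d_m A.
    by move=> mA; rewrite law// sz eqxx.
  have m2 : `|m| <= 2 * sig.
    rewrite leNgt; apply/negP => hm; move: cheb; rewrite preI /prob lawm//.
    rewrite diracE memNset /=; first by lra.
    by rewrite in_itv/= -ler_norml => h; move: hm; rewrite ltNge h.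
  have -> : [set w | y * sig < `|f w|] = f @^-1` [set x | y * sig < `|x - 0|].
    by apply/seteqP; split => w /=; rewrite subr0.
  rewrite /prob lawm// diracE memNset /=; first by lra.
  by rewrite subr0; apply/negP; rewrite -leNgt (le_trans m2)// ler_wpM2r ?ltW//; lra.
have sgt0 : 0 < s by rewrite lt_neqAle eq_sym snz.
have lawn A : measurable A -> P (f @^-1` A) = normal_prob m s A.
  by move=> mA; rewrite law// (negbTE snz).
have s3 : s <= 3 * sig.
  have h : prob P [set w | `|f w| <= 2 * sig] <= 2 * sig / s.
    rewrite preI -lee_fin -probE; last exact: mpre.
    by rewrite lawn// normal_prob_itv_le// mulr_ge0// ltW.
  have := le_trans cheb h; rewrite ler_pdivlMr// ; lra.
have tail z : 0 <= z -> prob P [set w | z < `|f w - m|] <=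
    2 * expR (- (3 * z ^+ 2 / (8 * s ^+ 2))).
  move=> z0; have -> : [set w | z < `|f w - m|] = f @^-1` [set x | z < `|x - m|] by [].
  rewrite -lee_fin -probE; last exact: mpre.
  by rewrite lawn//; exact: normal_prob_tail.
have s2 : 0 < s ^+ 2 by rewrite exprn_gt0.
(* otherwise the interval lies at distance more than [3 s] from the mean, where
   the mass is at most [2 e^(-27/8) < 3/4] *)
have m11 : `|m| <= 2 * sig + 3 * s.
  rewrite leNgt; apply/negP => hm.
  have h3 : 0 <= 3 * s by rewrite mulr_ge0.
  have h := tail _ h3.
  have e27 : 3 * (3 * s) ^+ 2 / (8 * s ^+ 2) = 27 / 8 by field; rewrite gt_eqF.
  rewrite e27 expRN in h.
  have hle : prob P [set w | `|f w| <= 2 * sig] <= prob P [set w | 3 * s < `|f w - m|].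
    apply: le_prob.
    - by rewrite preI; exact: mpre.
    - exact: (mpre [set x | 3 * s < `|x - m|]).
    - move=> w /= hw; have := ler_normD (m - f w) (f w); rewrite subrK distrC; lra.
  have h27 := expR_ge1Dx (27 / 8 : R).
  have i27 : (expR (27 / 8))^-1 <= (1 + 27 / 8)^-1 :> R.
    by rewrite lef_pV2 ?posrE ?expR_gt0//; lra.
  have : (1 + 27 / 8)^-1 = 8 / 35 :> R by field.
  lra.
have hy : 0 <= y * s / 6 by rewrite !mulr_ge0// ltW//; lra.
have eqy : 3 * (y * s / 6) ^+ 2 / (8 * s ^+ 2) = y ^+ 2 / 96 by field; rewrite gt_eqF.
rewrite -eqy; apply: le_trans (tail _ hy); apply: le_prob.
- have -> : [set w | y * sig < `|f w|] = f @^-1` [set x | y * sig < `|x - 0|].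
    by apply/seteqP; split => w /=; rewrite subr0.
  exact: mpre.
- exact: (mpre [set x | y * s / 6 < `|x - m|]).
- move=> w /= hw; have := ler_normD (f w - m) m; rewrite subrK.
  have : y * s <= y * (3 * sig) by rewrite ler_wpM2l//; lra.
  have : 22 * sig <= y * sig by rewrite ler_wpM2r// ltW.
  lra.
Qed.

End GaussianTail.

(** * Modulus of continuity of fractional Brownian motion *)

Section FractionalBrownianModulus.
Context {d : measure_display} {T : measurableType d} {R : realType}.
Variable P : probability T R.
Variables (H : R) (W : R -> {RV P >-> R}).
Hypothesis H01 : 0 < H < 1.
Hypothesis fbmW : fractional_brownian_motion H W.

Lemma fbm_sqr (u : R) : (\int[P]_w (W u w ^+ 2)%:E = (`|u| `^ (2 * H))%:E)%E.
Proof.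
have /andP[H0 H1] := H01.
have := fbm_cov fbmW u u; rewrite unlock subrr normr0 powR0; last first.
  by rewrite mulf_neq0 ?gt_eqF.
rewrite subr0 => h.
rewrite -[RHS](_ : ((`|u| `^ (2 * H) + `|u| `^ (2 * H)) / 2)%:E = _); last first.
  by congr EFin; field.
exact: h.
Qed.

Lemma integrable_fbm_mul (u v : R) :
  P.-integrable setT (EFin \o (fun w => W u w * W v w)).
Proof.
have mW t : measurable_fun setT (W t) by exact: measurable_funP.
have iW t : P.-integrable setT (EFin \o (fun w => W t w ^+ 2)).
  apply/integrableP; split.
    by apply/measurable_EFinP; exact: measurable_funX.
  under eq_integral do rewrite /= ger0_norm ?sqr_ge0//.
  by rewrite fbm_sqr ltry.
apply: (le_integrable _ _ _ (integrableD measurableT (iW u) (iW v))) => //.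
  by apply/measurable_EFinP; exact: measurable_funM.
move=> w _ /=; rewrite lee_fin [leRHS]ger0_norm ?addr_ge0 ?sqr_ge0//.
rewrite ler_norml; have := sqr_ge0 (W u w - W v w).
by have := sqr_ge0 (W u w + W v w); nra.
Qed.

Lemma fbm_increment_sqr (u v : R) :
  (\int[P]_w ((W u w - W v w) ^+ 2)%:E = (`|u - v| `^ (2 * H))%:E)%E.
Proof.
have i := integrable_fbm_mul.
have -> : (fun w => ((W u w - W v w) ^+ 2)%:E) =
   (fun w => ((W u w * W u w + W v w * W v w)%:E - (2 * (W u w * W v w))%:E)%E).
  by apply/funext => w; rewrite -EFinB; congr EFin; ring.
rewrite integralB_EFin//; last 2 first.
- exact: (integrableD measurableT (i u u) (i v v)).
- exact: (integrableZl measurableT 2 (i u v)).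
rewrite integralD_EFin//.
under [X in (_ - X)%E]eq_integral do rewrite EFinM.
rewrite integralZl//; last exact: i.
have c s t := fbm_cov fbmW s t; rewrite unlock in c.
rewrite /= !c -EFinM -!EFinD !subrr normr0 powR0; last first.
  by have /andP[H0 H1] := H01; rewrite mulf_neq0 ?gt_eqF.
by congr EFin; field.
Qed.

(** [r^H (log 1/r)^(1/2)] at [r = 2^(-n)]; the constant makes the Gaussian tail
    summable over the dyadic increments. *)
Definition fbm_modulus (n : nat) : R :=
  24 * Num.sqrt n.+1%:R * ((2 ^+ n)^-1) `^ H.

Lemma fbm_dyadic (K : nat) :
  {ae P, forall w, exists n0, forall n k, (n0 <= n)%N -> (k < K * 2 ^ n)%N ->
    `|W (k%:R / 2 ^+ n + (2 ^+ n)^-1) w - W (k%:R / 2 ^+ n) w| <= fbm_modulus n}.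
Proof.
pose A n k := [set w | fbm_modulus n <
  `|W (k%:R / 2 ^+ n + (2 ^+ n)^-1) w - W (k%:R / 2 ^+ n) w|].
have mf (u v : R) : measurable_fun setT (fun w => W u w - W v w).
  by apply: measurable_funB; exact: measurable_funP.
have mA n k : measurable (A n k).
  by apply: measurable_gt; apply: measurableT_comp => //; exact: mf.
have : {ae P, forall w, exists n0, forall n k, (n0 <= n)%N ->
    (k < K * 2 ^ n)%N -> ~ A n k w}.
  apply: (@borel_cantelli_dyadic _ _ _ P A K 2) => // n k.
  have e0 : 0 < (2 ^+ n)^-1 :> R by rewrite invr_gt0 exprn_gt0.
  have n1 : 1 <= n.+1%:R :> R by rewrite ler1n.
  pose u : R := k%:R / 2 ^+ n + (2 ^+ n)^-1; pose v : R := k%:R / 2 ^+ n.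
  rewrite /A -/u -/v.
  have gauss : normally_distributed P (fun w => W u w - W v w).
    have := fbm_gaussian fbmW (fun i : 'I_2 => if val i == 0%N then 1 else -1)
      (fun i : 'I_2 => if val i == 0%N then u else v).
    congr normally_distributed; apply/funext => w.
    by rewrite big_ord_recl big_ord1/= mul1r mulN1r.
  have sig0 : 0 < (2 ^+ n)^-1 `^ H :> R by rewrite powR_gt0.
  have y22 : 22 <= 24 * Num.sqrt n.+1%:R :> R.
    have : Num.sqrt 1 <= Num.sqrt n.+1%:R :> R by exact: ler_wsqrtr.
    rewrite sqrtr1.
    lra.
  apply: le_trans (gaussian_tail (mf u v) gauss sig0 y22 _) _.
    rewrite fbm_increment_sqr /u /v addrAC subrr add0r gtr0_norm//.
    by rewrite mulrC powRrM powR_mulrn// powR_ge0.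
  rewrite ler_pM2l//; apply: le_trans (expR_neg2_le n).
  rewrite ler_expR lerN2 exprMn sqr_sqrtr//; lra.
apply: filterS => w [n0 hn]; exists n0 => n k nn kb.
by rewrite leNgt; apply/negP; exact: hn.
Qed.

(** A ratio strictly between [2^(-H)] and [1], so that the slowly growing factor
    of the modulus is absorbed at fine levels. *)
Definition fbm_ratio : R := 2 `^ (- (H / 2)).

Lemma fbm_ratio01 : 0 <= fbm_ratio < 1.
Proof.
have /andP[H0 H1] := H01.
rewrite /fbm_ratio powR_ge0/= powRN invf_lt1 ?powR_gt0//.
have : 1 `^ (H / 2) < 2 `^ (H / 2) :> R.
  by rewrite gt0_ltr_powR ?divr_gt0 ?nnegrE// ltr1n.
by rewrite powR1.
Qed.

Lemma fbm_modulus_ratio : exists n0, forall n, (n0 <= n)%N ->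
  fbm_modulus n.+1 <= fbm_ratio * fbm_modulus n.
Proof.
have /andP[H0 H1] := H01.
have h21 : 1 < 2 `^ H :> R.
  have : 1 `^ H < 2 `^ H :> R by rewrite gt0_ltr_powR ?nnegrE// ltr1n.
  by rewrite powR1.
have [m hm] := @inv_small _ 1 (2 `^ H - 1) ltr01 (ltac:(by rewrite subr_gt0)).
exists m => n mn; rewrite /fbm_modulus.
have n0 : 0 < n.+1%:R :> R by [].
have e0 : 0 < (2 ^+ n)^-1 :> R by rewrite invr_gt0 exprn_gt0.
have -> : (2 ^+ n.+1)^-1 = 2^-1 * (2 ^+ n)^-1 :> R by rewrite exprS invfM.
rewrite powRM ?invr_ge0 ?(ltW e0)//.
have s1 : Num.sqrt n.+2%:R <= Num.sqrt n.+1%:R * 2 `^ (H / 2) :> R.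
  have -> : 2 `^ (H / 2) = Num.sqrt (2 `^ H) :> R.
    by rewrite -powR12_sqrt ?powR_ge0// -powRrM.
  rewrite -sqrtrM ?ler0n//; apply: ler_wsqrtr.
  have := hm _ mn; rewrite ltr_pdivrMr// => h.
  rewrite -natr1; nra.
have s2 : 2^-1 `^ H * 2 `^ (H / 2) = fbm_ratio :> R.
  rewrite /fbm_ratio -[X in X `^ H]powR_inv1// -powRrM mulN1r -powRD; last first.
    by rewrite pnatr_eq0 implybT.
  by congr (_ `^ _); field.
have -> : fbm_ratio * (24 * Num.sqrt n.+1%:R * (2 ^+ n)^-1 `^ H) =
  24 * (Num.sqrt n.+1%:R * 2 `^ (H / 2)) * (2^-1 `^ H * (2 ^+ n)^-1 `^ H).
  by rewrite -s2; ring.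
by rewrite ler_wpM2r ?mulr_ge0 ?powR_ge0// ler_wpM2l.
Qed.

Lemma fbm_modulus_ge0 n : 0 <= fbm_modulus n.
Proof. by rewrite /fbm_modulus !mulr_ge0 ?powR_ge0 ?sqrtr_ge0. Qed.

Lemma fbm_uniform_modulus : {ae P, forall w, forall K : nat,
  exists n0, forall n, (n0 <= n)%N -> forall u v : R, 0 <= u < K%:R -> 0 <= v < K%:R ->
    `|u - v| <= (2 ^+ n)^-1 ->
    `|W u w - W v w| <= 3 / (1 - fbm_ratio) * fbm_modulus n}.
Proof.
have hK := (ae_foralln (fun K => fbm_dyadic K)).
have hC := fbm_continuous fbmW.
apply: filterS2 hK hC => w h contW K.
have [n0 hn0] := h K; have [n1 hn1] := fbm_modulus_ratio.
exists (maxn n0 n1) => n nn u v uK vK uv.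
apply: (@chaining _ (fun t => W t w) fbm_modulus fbm_ratio K (maxn n0 n1)) uv => //.
- exact: fbm_ratio01.
- exact: fbm_modulus_ge0.
- by move=> m mm; apply: hn1; exact: leq_trans (leq_maxr _ _) mm.
- by move=> m k mm; apply: hn0; exact: leq_trans (leq_maxl _ _) mm.
Qed.

End FractionalBrownianModulus.

(** * Composition of the moduli *)

Section Assembly.
Context {R : realType}.
Implicit Types (h s t u v b H gamma Cw : R).

Lemma powR_inv_exp2 (n : nat) (x : R) : ((2 ^+ n)^-1) `^ x = (2 ^+ n) `^ (- x).
Proof. by rewrite -[X in X `^ _]powR_inv1 ?exprn_ge0// -powRrM mulN1r. Qed.

Lemma gauge_ge h (a c : R) (n : nat) : 0 <= a -> 0 <= c -> (0 < n)%N ->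
  (2 ^+ n.+1)^-1 < h -> h <= (2 ^+ n)^-1 ->
  2 `^ (- a) * (ln 2 / 2) `^ c * ((2 ^+ n) `^ (- a) * n.+1%:R `^ c)
    <= h `^ a * ln (1 / h) `^ c.
Proof.
move=> a0 c0 n0 h1 h2.
have e0 k : 0 < 2 ^+ k :> R by rewrite exprn_gt0.
have h0 : 0 < h by apply: lt_trans h1; rewrite invr_gt0.
have l2 : 0 < ln 2 :> R by rewrite ln_gt0// ltr1n.
have p1 : 2 `^ (- a) * (2 ^+ n) `^ (- a) <= h `^ a.
  rewrite -powRM ?(ltW (e0 n))// -exprS -powR_inv_exp2.
  by rewrite ge0_ler_powR ?nnegrE ?invr_ge0 ?(ltW h0) ?(ltW (e0 _)) ?(ltW h1).
have p2 : (ln 2 / 2) `^ c * n.+1%:R `^ c <= ln (1 / h) `^ c.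
  have l20 : 0 <= ln 2 / 2 :> R by rewrite divr_ge0// ltW.
  rewrite -powRM//.
  have hl : ln 2 / 2 * n.+1%:R <= ln (1 / h) :> R.
    apply: (@le_trans _ _ (n%:R * ln 2)).
      have : 1 <= n%:R :> R by rewrite ler1n.
      rewrite -[n.+1%:R]natr1; nra.
    rewrite mulr_natl -lnXn// ler_ln ?posrE ?divr_gt0//.
    by rewrite div1r -[leLHS]invrK lef_pV2 ?posrE ?invr_gt0.
  have hl0 : 0 <= ln 2 / 2 * n.+1%:R :> R by rewrite mulr_ge0.
  by rewrite ge0_ler_powR ?nnegrE// (le_trans hl0).
have -> : 2 `^ (- a) * (ln 2 / 2) `^ c * ((2 ^+ n) `^ (- a) * n.+1%:R `^ c) =
  (2 `^ (- a) * (2 ^+ n) `^ (- a)) * ((ln 2 / 2) `^ c * n.+1%:R `^ c) by ring.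
by apply: ler_pM; rewrite ?mulr_ge0 ?powR_ge0.
Qed.

(** The increment of the local time is at most [eta], which [2^(-m)] exceeds by
    a factor less than [2]; since [m <= n], the logarithm at the scale of the
    space variable is bounded by the one at the scale of the time variable. *)
Lemma composed_modulus H gamma (G eta : R) (m n : nat) : 0 < H -> 0 <= G ->
  eta = 2 * (G * (2 ^+ n) `^ (- (1 - gamma)) * n.+1%:R `^ gamma) ->
  (m <= n)%N -> (2 ^+ m.+1)^-1 < eta ->
  fbm_modulus H m <=
    24 * (4 * G) `^ H *
    ((2 ^+ n) `^ (- (H * (1 - gamma))) * n.+1%:R `^ (1 / 2 + H * gamma)).
Proof.
move=> H0 G0 etaE mn meta.
have e0 k : 0 < 2 ^+ k :> R by rewrite exprn_gt0.
have n0 : 0 < n.+1%:R :> R by [].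
have me : (2 ^+ m)^-1 <= 4 * G * ((2 ^+ n) `^ (- (1 - gamma)) * n.+1%:R `^ gamma).
  have : (2 ^+ m)^-1 = 2 * (2 ^+ m.+1)^-1 :> R by rewrite exprS; field; rewrite gt_eqF.
  by move=> ->; move: meta; rewrite etaE => meta; lra.
rewrite /fbm_modulus.
have s1 : Num.sqrt m.+1%:R <= n.+1%:R `^ (1 / 2) :> R.
  by rewrite div1r powR12_sqrt//; apply: ler_wsqrtr; rewrite ler_nat.
have s2 : (2 ^+ m)^-1 `^ H <= (4 * G) `^ H *
    ((2 ^+ n) `^ (- (H * (1 - gamma))) * n.+1%:R `^ (H * gamma)).
  have -> : (4 * G) `^ H *
     ((2 ^+ n) `^ (- (H * (1 - gamma))) * n.+1%:R `^ (H * gamma)) =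
     (4 * G * ((2 ^+ n) `^ (- (1 - gamma)) * n.+1%:R `^ gamma)) `^ H.
    rewrite !powRM ?mulr_ge0 ?powR_ge0// -!powRrM; congr (_ * (_ `^ _ * _ `^ _)); ring.
  by rewrite ge0_ler_powR ?nnegrE ?invr_ge0 ?mulr_ge0 ?powR_ge0// ltW.
have -> : n.+1%:R `^ (1 / 2 + H * gamma) =
    n.+1%:R `^ (1 / 2) * n.+1%:R `^ (H * gamma) :> R.
  by rewrite powRD// (gt_eqF n0) implybT.
set A := n.+1%:R `^ (1 / 2) in s1 *; set B := n.+1%:R `^ (H * gamma) in s2 *.
set D := (2 ^+ n) `^ _ in s2 *; set F := (4 * G) `^ H in s2 *.
have -> : 24 * F * (D * (A * B)) = 24 * A * (F * (D * B)) by ring.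
apply: ler_pM; rewrite ?mulr_ge0 ?sqrtr_ge0 ?powR_ge0//.
by rewrite ler_wpM2l.
Qed.

Definition composed_const H gamma C0 : R :=
  24 * (4 * (3 * visit_const gamma C0)) `^ H /
  (2 `^ (- (H * (1 - gamma))) * (ln 2 / 2) `^ (1 / 2 + H * gamma)).

Lemma composed_const_gt0 H gamma C0 : 0 < gamma < 1 -> 0 < C0 ->
  0 < composed_const H gamma C0.
Proof.
move=> gamma01 C00; have G0 := visit_const_gt0 gamma01 C00.
have l2 : 0 < ln 2 :> R by rewrite ln_gt0// ltr1n.
apply: divr_gt0; apply: mulr_gt0; rewrite ?powR_gt0 ?divr_gt0//.
by apply: mulr_gt0 => //; exact: mulr_gt0.
Qed.

(** The pathwise part of the argument: the modulus of [f \o l] is the composition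
    of the moduli of [f] and [l]. *)
Lemma composed_increment_le H gamma C0 Cw b (f l : R -> R) :
  0 < H -> 0 < gamma < 1 -> 4^-1 <= C0 -> 0 < Cw -> 0 <= b ->
  l 0 = 0 -> (forall s t, 0 <= s -> s <= t -> l s <= l t) ->
  (exists n0, forall n, (n0 <= n)%N -> forall s t, 0 <= s -> s <= t -> t <= b ->
     t - s <= (2 ^+ n)^-1 -> l t - l s <= 2 * local_time_modulus gamma C0 n) ->
  (forall K : nat, exists n0, forall n, (n0 <= n)%N -> forall u v,
     0 <= u < K%:R -> 0 <= v < K%:R -> `|u - v| <= (2 ^+ n)^-1 ->
     `|f u - f v| <= Cw * fbm_modulus H n) ->
  exists2 e, 0 < e & forall h t s, 0 < h < e -> 0 <= t <= b - h -> 0 <= s <= h ->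
    `|f (l (t + s)) - f (l t)| /
      (h `^ (H * (1 - gamma)) * ln (1 / h) `^ (1 / 2 + H * gamma)) <=
    Cw * composed_const H gamma C0.
Proof.
move=> H0 gamma01 C01 Cw0 b0 l0 lmono [n0 hn0] hf.
have C00 : 0 < C0 by apply: lt_le_trans C01; rewrite invr_gt0.
have /andP[g0 g1] := gamma01.
have G0 : 0 < 3 * visit_const gamma C0 by apply: mulr_gt0 => //; exact: visit_const_gt0.
pose ea := H * (1 - gamma); pose ec := 1 / 2 + H * gamma.
have ea0 : 0 <= ea by rewrite mulr_ge0// ?subr_ge0 ltW.
have ec0 : 0 <= ec by rewrite addr_ge0// mulr_ge0// ltW.
pose K := (Num.truncn (l b)).+1.
have lK t : 0 <= t -> t <= b -> 0 <= l t < K%:R.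
  move=> t0 tb; have := lmono _ _ (lexx 0) t0; rewrite l0 => -> /=.
  have lb : 0 <= l b by have := lmono _ _ (lexx 0) b0; rewrite l0.
  have /andP[_ hK] := truncn_itv lb.
  exact: le_lt_trans (lmono _ _ t0 tb) hK.
have [m0 hm0] := hf K.
have i0 k : 0 < (2 ^+ k)^-1 :> R by rewrite invr_gt0 exprn_gt0.
have i1 k : (2 ^+ k)^-1 <= 1 :> R.
  by rewrite invf_le1 ?exprn_gt0// exprn_ege1// ler1n.
have m02 : 0 < (2 ^+ m0)^-1 / 2 :> R by rewrite divr_gt0.
have [n1 hn1] := local_time_modulus_small gamma01 C00 m02.
(* [n1] brings the increments of [l] below the scale from which [f] is
   controlled, and the [1] makes the logarithm nonzero *)
pose N := (maxn (maxn n0 n1) (maxn m0 1)).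
exists (2 ^+ N)^-1 => // h t s /andP[h0 hN] /andP[t0 tbh] /andP[s0 sh].
have [|n /andP[nh hn]] := @dyadic_bracket R h.
  by rewrite h0 (le_trans (ltW hN)).
have Nn : (N <= n)%N := dyadic_bracket_ge nh (ltW hN).
have [n0n n1n m0n n_gt0] : [/\ (n0 <= n)%N, (n1 <= n)%N, (m0 <= n)%N & (0 < n)%N].
  by move: Nn; rewrite !geq_max -andbA => /and4P.
have tsb : t + s <= b by lra.
have ts0 : 0 <= t + s by lra.
have tb : t <= b by lra.
pose eta := 2 * local_time_modulus gamma C0 n.
have inc0 : l t <= l (t + s) by apply: lmono => //; rewrite lerDl.
have inc : l (t + s) - l t <= eta.
  apply: hn0 => //; first by rewrite lerDl.
  by rewrite addrAC subrr add0r (le_trans sh).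
have etam0 : eta <= (2 ^+ m0)^-1 by have := hn1 n n1n; rewrite /eta; lra.
have etan : (2 ^+ n)^-1 <= eta by exact: local_time_modulus_ge_inv.
have eta0 : 0 < eta by exact: lt_le_trans etan.
have [|m /andP[meta etam]] := @dyadic_bracket R eta.
  by rewrite eta0 (le_trans etam0).
have m0m : (m0 <= m)%N := dyadic_bracket_ge meta etam0.
have mn : (m <= n)%N.
  have := le_trans etan etam.
  by rewrite lef_pV2 ?posrE ?exprn_gt0// -!natrX ler_nat leq_exp2l.
have numle : `|f (l (t + s)) - f (l t)| <= Cw * fbm_modulus H m.
  apply: hm0 => //; [exact: lK|exact: lK|].
  by rewrite ger0_norm ?subr_ge0// (le_trans inc).
have comp := composed_modulus H0 (ltW G0) (erefl eta) mn meta.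
have gauge := gauge_ge ea0 ec0 n_gt0 nh hn.
rewrite -/ea -/ec in comp *; rewrite /composed_const -/ea -/ec.
set S := (2 ^+ n) `^ (- ea) * n.+1%:R `^ ec in comp gauge.
have S0 : 0 < S by rewrite mulr_gt0 ?powR_gt0 ?exprn_gt0.
set Cd := 2 `^ (- ea) * (ln 2 / 2) `^ ec in gauge *.
have Cd0 : 0 < Cd by rewrite mulr_gt0 ?powR_gt0// divr_gt0// ln_gt0// ltr1n.
set D := h `^ ea * _ in gauge *; set F := 24 * _ `^ H in comp *.
have F0 : 0 <= F by apply: mulr_ge0 => //; exact: powR_ge0.
rewrite ler_pdivrMr; last by apply: lt_le_trans gauge; exact: mulr_gt0.
apply: le_trans numle _; rewrite -mulrA ler_pM2l//.
apply: le_trans comp _; rewrite -[leRHS]mulrA ler_wpM2l//.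
by rewrite ler_pdivlMl.
Qed.

Lemma limsup_sup_le (phi : R -> R -> R -> R) (a b A e : R) : 0 < e ->
  (forall h t s, 0 < h < e -> a <= t <= b - h -> 0 <= s <= h -> phi h t s <= A) ->
  (limf_esup (fun h => (ereal_sup [set ereal_sup [set (phi h t s)%:E
      | s in `[0%R, h]%classic] | t in `[a, (b - h)%R]%classic]))
    (0 : R)^'+ <= A%:E)%E.
Proof.
move=> e0 hphi; rewrite limf_esupE; apply: ge_ereal_inf.
exists (ereal_sup ((fun h : R => (ereal_sup [set ereal_sup [set (phi h t s)%:E
     | s in `[0%R, h]%classic] | t in `[a, (b - h)%R]%classic]))
   @` `]0%R, e[%classic)).
  exists (`]0, e[%classic) => //.
  near=> h; rewrite /= in_itv/=; apply/andP; split; near: h.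
    exact: nbhs_right_gt.
  exact: nbhs_right_lt.
apply: ge_ereal_sup => _ [h /= + <-]; rewrite in_itv/= => hh.
apply: ge_ereal_sup => _ [t /= + <-]; rewrite in_itv/= => ht.
apply: ge_ereal_sup => _ [s /= + <-]; rewrite in_itv/= => hs.
by rewrite lee_fin; exact: hphi.
Unshelve. all: by end_near.
Qed.

End Assembly.

Theorem theorem5p1 (R : realType) (d : measure_display) (T : measurableType d)
    (P : probability T R) (H alpha nu chi : R)
    (W : R -> {RV P >-> R}) (X : R -> {RV P >-> R})
    (L : R -> R -> {RV P >-> R}) :
  0 < H < 1 -> 1 < alpha <= 2 -> -1 <= nu <= 1 -> 0 < chi ->
  fractional_brownian_motion H W ->
  stable_levy_process alpha nu chi X ->
  independent_processes setT [set t | 0 <= t] W X ->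
  local_time X L ->
  let Z := local_time_fbm W L in
  exists A9 : R, 0 < A9 /\
    forall a b : R, 0 <= a -> a < b ->
      {ae P, forall w,
        (limf_esup (fun h : R =>
           (ereal_sup [set ereal_sup
             [set (`|Z (t + s) w - Z t w| /
                   (h `^ (H * (alpha - 1) / alpha) *
                    ln (1 / h) `^ ((alpha + 2 * H) / (2 * alpha))))%:E
             | s in `[0, h]] | t in `[a, b - h]])%R)
         (0 : R)^'+ <= A9%:E)%E}.
Proof.
move=> H01 alpha12 nu1 chi0 fbmW stableX indepWX localL Z.
have /andP[H0 H1] := H01; have /andP[alpha1 _] := alpha12.
have alpha0 : 0 < alpha := lt_trans ltr01 alpha1.
pose gamma := alpha^-1.
have gamma01 : 0 < gamma < 1 by rewrite invr_gt0 alpha0 invf_lt1.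
have levyX := stable_levy stableX.
have smallX := stable_small_ball alpha1 chi0 stableX.
have C01 := small_ball_const_ge chi0.
have C00 : 0 < small_ball_const chi by apply: lt_le_trans C01; rewrite invr_gt0.
have /andP[_ rho1] := fbm_ratio01 H01.
have Cw0 : 0 < 3 / (1 - fbm_ratio H) by rewrite divr_gt0// subr_gt0.
exists (3 / (1 - fbm_ratio H) * composed_const H gamma (small_ball_const chi)); split.
  by rewrite mulr_gt0// composed_const_gt0.
move=> a b a0 ab.
have b0 : 0 <= b := le_trans a0 (ltW ab).
have -> : H * (alpha - 1) / alpha = H * (1 - gamma).
  by rewrite /gamma; field; rewrite gt_eqF.
have -> : (alpha + 2 * H) / (2 * alpha) = 1 / 2 + H * gamma.
  by rewrite /gamma; field; rewrite gt_eqF.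
apply: filterS2 (local_time_uniform_modulus levyX localL gamma01 C00 smallX b)
  (fbm_uniform_modulus H01 fbmW) => w [l0 lmono lmod] Wmod.
have [e e0 he] := composed_increment_le (f := W ^~ w) (l := fun t => L 0 t w)
  H0 gamma01 C01 Cw0 b0 l0 lmono lmod Wmod.
apply: (limsup_sup_le (phi := fun h t s => `|Z (t + s) w - Z t w| /
   (h `^ (H * (1 - gamma)) * ln (1 / h) `^ (1 / 2 + H * gamma))) e0).
move=> h t s hh /andP[at_ tb] hs.
by apply: he => //; rewrite (le_trans a0 at_).
Qed.
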